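(* Let $A(t)$ be an $n\times n$ matrix, invertible over $\mathbb{C}((t))$, whose entries $A_{ij}(t)$ are algebraic functions in $t$ regarded as Laurent series (i.e. elements of $\mathbb{C}((t))$ algebraic over $\mathbb{C}(t)$). For sufficiently small real $t>0$, let $d_1(t)\le\cdots\le d_n(t)$ denote the singular values of $A(t)$ ordered increasingly. Let $v_1\ge\cdots\ge v_n$ be the invariant factors of $A(t)$ ordered decreasingly. Then $$\lim_{t\to0}\big(\log_t(d_1(t)),\ldots,\log_t(d_n(t))\big)=(v_1,\ldots,v_n).$$
   Context: The singular values of a complex $n\times n$ matrix $M$ are the eigenvalues of the positive semidefinite matrix $\sqrt{MM^*}$, $M^*=\overline{M}^{\,t}$. Invariant factors: by the Smith normal form theorem over $\mathbb{C}[[t]]$, an invertible matrix $A(t)$ over $\mathbb{C}((t))$ can be written $A(t)=A_1(t)\,\tau(t)\,A_2(t)$ with $A_1(t),A_2(t)\in\mathrm{GL}(n,\mathbb{C}[[t]])$ and $\tau(t)=\mathrm{diag}(t^{v_1},\ldots,t^{v_n})$; the integers $v_1,\dots,v_n$ (unique up to order) are the invariant factors of $A(t)$. Here $\log_t(x)=\log x/\log t$. Laurent series algebraic over $\mathbb{C}(t)$ converge in a punctured neighbourhood of $0$, so $A(t)$ can be evaluated at small $t>0$. *)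

(* Defs.v *)
From HB Require Import structures.
From mathcomp Require Import all_boot all_order all_algebra.
From mathcomp Require Import all_classical all_reals all_analysis.
From mathcomp Require Import complex zify.

Set Implicit Arguments.
Unset Strict Implicit.
Unset Printing Implicit Defensive.

Import Order.TTheory GRing.Theory Num.Theory.
Import numFieldNormedType.Exports.

Local Open Scope classical_set_scope.
Local Open Scope complex_scope.
Local Open Scope ring_scope.

(** * The ring K[[t]] *)

Record fps (K : Type) := Fps { fps_coef : nat -> K }.

HB.instance Definition _ (K : Type) := gen_eqMixin (fps K).
HB.instance Definition _ (K : Type) := gen_choiceMixin (fps K).

Section FpsRing.
Variable K : fieldType.
Implicit Types f g h : fps K.

Local Notation "f `[ i ]" := (fps_coef f i) (at level 2, format "f `[ i ]").

Lemma fpsP f g : (forall i, f`[i] = g`[i]) -> f = g.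
Proof. by case: f g => [f] [g] /= /funext ->. Qed.

Definition fps_of_poly (p : {poly K}) : fps K := Fps (fun i => p`_i).

Definition fps0 := fps_of_poly 0.
Definition fps1 := fps_of_poly 1.
Definition fps_opp f := Fps (fun i => - f`[i]).
Definition fps_add f g := Fps (fun i => f`[i] + g`[i]).
Definition fps_mul f g := Fps (fun n => \sum_(i < n.+1) f`[i] * g`[n - i]).

Fact fps_addA : associative fps_add.
Proof. by move=> f g h; apply: fpsP => i /=; rewrite addrA. Qed.
Fact fps_addC : commutative fps_add.
Proof. by move=> f g; apply: fpsP => i /=; rewrite addrC. Qed.
Fact fps_add0 : left_id fps0 fps_add.
Proof. by move=> f; apply: fpsP => i /=; rewrite coef0 add0r. Qed.
Fact fps_addN : left_inverse fps0 fps_opp fps_add.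
Proof. by move=> f; apply: fpsP => i /=; rewrite coef0 addNr. Qed.

HB.instance Definition _ :=
  GRing.isZmodule.Build (fps K) fps_addA fps_addC fps_add0 fps_addN.

Definition fps_trunc N f : {poly K} := \poly_(i < N) f`[i].

Lemma coef_fps_trunc N f i : (i < N)%N -> (fps_trunc N f)`_i = f`[i].
Proof. by move=> iN; rewrite coef_poly iN. Qed.

Lemma fps_mul_trunc N f g n : (n < N)%N ->
  (fps_mul f g)`[n] = (fps_trunc N f * fps_trunc N g)`_n.
Proof.
move=> nN; rewrite coefM; apply: eq_bigr => i _.
by rewrite !coef_fps_trunc //; have := ltn_ord i; lia.
Qed.

Fact fps_mulA : associative fps_mul.
Proof.
move=> f g h; apply: fpsP => n.
transitivity ((fps_trunc n.+1 f * fps_trunc n.+1 g * fps_trunc n.+1 h)`_n).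
  rewrite -mulrA coefM; apply: eq_bigr => i _.
  by rewrite coef_fps_trunc // (@fps_mul_trunc n.+1) //; have := ltn_ord i; lia.
rewrite coefM; apply: eq_bigr => i _.
by rewrite -(@fps_mul_trunc n.+1) ?coef_fps_trunc //; have := ltn_ord i; lia.
Qed.

Fact fps_mulC : commutative fps_mul.
Proof. by move=> f g; apply: fpsP => n; rewrite !(@fps_mul_trunc n.+1) // mulrC. Qed.

Fact fps_mul1 : left_id fps1 fps_mul.
Proof.
move=> f; apply: fpsP => n /=.
rewrite big_ord_recl /= coefC eqxx mul1r subn0 big1 ?addr0 // => i _.
by rewrite coefC /= mul0r.
Qed.

Fact fps_mulD : left_distributive fps_mul fps_add.
Proof.
move=> f g h; apply: fpsP => n /=; rewrite -big_split /=.
by apply: eq_bigr => i _; rewrite mulrDl.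
Qed.

Fact fps1_neq0 : fps1 != 0.
Proof.
apply/eqP => /(congr1 (fun f => f`[0])) /=.
by rewrite coef0 coefC /=; apply/eqP/oner_neq0.
Qed.

HB.instance Definition _ := GRing.Zmodule_isComNzRing.Build (fps K)
  fps_mulA fps_mulC fps_mul1 fps_mulD fps1_neq0.

Lemma fps_coefM f g n :
  (f * g)`[n] = \sum_(i < n.+1) f`[i] * g`[n - i].
Proof. by []. Qed.

Fixpoint fps_inv_seq f n : seq K :=
  if n isn't m.+1 then [:: f`[0]^-1] else
  let s := fps_inv_seq f m in
  rcons s (- f`[0]^-1 * \sum_(i < m.+1) s`_i * f`[m.+1 - i]).

Definition fps_unit : {pred fps K} := fun f => f`[0] != 0.
Definition fps_inv f :=
  if fps_unit f then Fps (fun n => (fps_inv_seq f n)`_n) else f.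

Lemma size_fps_inv_seq f n : size (fps_inv_seq f n) = n.+1.
Proof. by elim: n => //= n IH; rewrite size_rcons IH. Qed.

Lemma nth_fps_inv_seq f n i : (i <= n)%N ->
  (fps_inv_seq f n)`_i = (fps_inv_seq f i)`_i.
Proof.
elim: n => [|n IH]; first by rewrite leqn0 => /eqP->.
rewrite leq_eqVlt => /orP[/eqP-> //|]; rewrite ltnS => le_in.
by rewrite /= nth_rcons size_fps_inv_seq ltnS le_in IH.
Qed.

Fact fps_mulV : {in fps_unit, left_inverse 1 fps_inv *%R}.
Proof.
move=> f uf; rewrite /fps_inv [fps_unit f]uf; apply: fpsP => n.
rewrite fps_coefM /= coefC; case: n => [|n].
  by rewrite big_ord1 /= mulVf.
rewrite big_ord_recr /= subnn nth_rcons size_fps_inv_seq ltnn eqxx.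
rewrite mulrAC mulNr mulVf // mulN1r; apply/eqP; rewrite subr_eq0; apply/eqP.
by apply: eq_bigr => i _; rewrite (@nth_fps_inv_seq f n i) // -ltnS.
Qed.

Fact fps_unitPl f g : g * f = 1 -> fps_unit f.
Proof.
move=> /(congr1 (fun h => h`[0])); rewrite fps_coefM big_ord1 /= coefC eqxx.
move=> gf1; apply/eqP => f0; move: gf1; rewrite f0 mulr0.
by move/esym/eqP; rewrite oner_eq0.
Qed.

Fact fps_inv_out : {in [predC fps_unit], fps_inv =1 id}.
Proof. by move=> f; rewrite inE /fps_inv => /negPf uf; rewrite [fps_unit f]uf. Qed.

HB.instance Definition _ := GRing.ComNzRing_hasMulInverse.Build (fps K)
  fps_mulV fps_unitPl fps_inv_out.

Lemma fps_val_ex f : f != 0 -> exists m, f`[m] != 0.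
Proof.
move=> f0; apply: contrapT => /forallNP all0; move/eqP: f0; apply.
by apply: fpsP => i /=; rewrite coef0; apply/eqP; apply: contra_notT (all0 i).
Qed.

Fact fps_idomain f g : f * g = 0 -> (f == 0) || (g == 0).
Proof.
apply: contra_eqT; rewrite negb_or => /andP[/fps_val_ex f0 /fps_val_ex g0].
case: (ex_minnP f0) => a fa mina; case: (ex_minnP g0) => b gb minb.
apply/eqP => /(congr1 (fun h => h`[a + b])); rewrite fps_coefM /= coef0.
have aP : (a < (a + b).+1)%N by lia.
rewrite (bigD1 (Ordinal aP)) //= addKn big1 ?addr0 => [/eqP|i /eqP ia].
  by rewrite mulf_eq0 (negPf fa) (negPf gb).
have {}ia : nat_of_ord i <> a by move=> ia'; apply: ia; apply: val_inj.
have [lt_ia|le_ai] := ltnP i a.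
  rewrite (_ : f`[i] = 0) ?mul0r //; apply/eqP; apply: contraTT lt_ia => fi.
  by rewrite -leqNgt mina.
rewrite (_ : g`[_] = 0) ?mulr0 //; apply/eqP.
have : (a + b - i < b)%N by have := ltn_ord i; lia.
apply: contraTT => gi.
by rewrite -leqNgt minb.
Qed.

HB.instance Definition _ :=
  GRing.ComUnitRing_isIntegral.Build (fps K) fps_idomain.

Fact fps_of_poly_zmod_morphism : zmod_morphism fps_of_poly.
Proof. by move=> p q; apply: fpsP => i /=; rewrite coefB. Qed.
Fact fps_of_poly_monoid_morphism : monoid_morphism fps_of_poly.
Proof. by split=> // p q; apply: fpsP => i; rewrite fps_coefM /= coefM. Qed.
HB.instance Definition _ :=
  GRing.isZmodMorphism.Build _ _ fps_of_poly fps_of_poly_zmod_morphism.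
HB.instance Definition _ :=
  GRing.isMonoidMorphism.Build _ _ fps_of_poly fps_of_poly_monoid_morphism.

Lemma fps_of_poly_inj : injective fps_of_poly.
Proof.
by move=> p q pq; apply/polyP => i; have /(congr1 (fun f => f`[i])) := pq.
Qed.

End FpsRing.

(** * The field K((t)), as the fraction field of K[[t]] *)

Notation "x %:F" := (FracField.tofrac x) : ring_scope.
Notation laurent K := {fraction fps K}.
Notation ratfun K := {fraction {poly K}}.

Lemma frac_numden (D : idomainType) (q : {fraction D}) :
  q = (repr q).1%:F / (repr q).2%:F.
Proof.
have d0 : (repr q).2%:F != 0 :> {fraction D}.
  by rewrite tofrac_eq0 denom_ratioP.
apply: (mulIf d0); rewrite mulfVK // -[q in q * _]reprK; unlock FracField.tofrac.
rewrite -[LHS]FracField.pi_mul; apply/eqmodP => /=.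
rewrite equivfE /FracField.mulf !numden_Ratio ?(mulr1, oner_neq0, denom_ratioP) //.
by rewrite mulrC.
Qed.

Section Laurent.
Variable K : fieldType.
Implicit Types f : laurent K.

Definition laurent_t : laurent K := (fps_of_poly 'X)%:F.

(* The inclusion of K(t) into K((t)), computed on a fraction representing the
   argument; laurent_of_ratfunE shows that the choice is immaterial. *)
Definition laurent_of_ratfun (q : ratfun K) : laurent K :=
  (fps_of_poly (repr q).1)%:F / (fps_of_poly (repr q).2)%:F.

Let emb (p : {poly K}) : laurent K := (fps_of_poly p)%:F.

Fact emb_neq0 p : p != 0 -> emb p != 0.
Proof.
by rewrite /emb tofrac_eq0 -(rmorph0 (@fps_of_poly K)) (inj_eq (@fps_of_poly_inj K)).
Qed.

Lemma laurent_of_ratfunE (a b : {poly K}) : b != 0 ->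
  laurent_of_ratfun (a%:F / b%:F) = (fps_of_poly a)%:F / (fps_of_poly b)%:F.
Proof.
move=> b0; rewrite /laurent_of_ratfun; have := frac_numden (a%:F / b%:F).
set q := repr _; have d0 : q.2 != 0 by exact: denom_ratioP.
move=> /esym/eqP; rewrite !eqr_div ?tofrac_eq0 // -!tofracM tofrac_eq => /eqP ab.
by apply/eqP; rewrite eqr_div ?emb_neq0 // -!tofracM -!rmorphM ab.
Qed.

Fact laurent_of_ratfun_zmod_morphism : zmod_morphism laurent_of_ratfun.
Proof.
move=> p q; rewrite (frac_numden p) (frac_numden q).
move: (denom_ratioP (repr p)) (denom_ratioP (repr q)).
move: (repr p).1 (repr p).2 (repr q).1 (repr q).2 => a b c d b0 d0.
rewrite !laurent_of_ratfunE // -!mulNr -!rmorphN !addf_div ?emb_neq0 ?tofrac_eq0 //.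
by rewrite -!rmorphM -!rmorphD laurent_of_ratfunE // mulf_neq0.
Qed.

Fact laurent_of_ratfun_monoid_morphism : monoid_morphism laurent_of_ratfun.
Proof.
split=> [|p q].
  have -> : 1 = 1%:F / 1%:F :> ratfun K by rewrite tofrac1 divr1.
  by rewrite laurent_of_ratfunE ?oner_neq0 // !rmorph1 divr1.
rewrite (frac_numden p) (frac_numden q).
move: (denom_ratioP (repr p)) (denom_ratioP (repr q)).
move: (repr p).1 (repr p).2 (repr q).1 (repr q).2 => a b c d b0 d0.
rewrite !laurent_of_ratfunE // !mulf_div -!rmorphM.
by rewrite laurent_of_ratfunE // mulf_neq0.
Qed.

HB.instance Definition _ := GRing.isZmodMorphism.Build _ _
  laurent_of_ratfun laurent_of_ratfun_zmod_morphism.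
HB.instance Definition _ := GRing.isMonoidMorphism.Build _ _
  laurent_of_ratfun laurent_of_ratfun_monoid_morphism.

Lemma laurent_shift f :
  exists p : nat * fps K, f = p.2%:F / laurent_t ^+ p.1.
Proof.
rewrite (frac_numden f).
move: (denom_ratioP (repr f)); move: (repr f).1 (repr f).2 => a b b0.
case: (ex_minnP (fps_val_ex b0)) => m bm minm.
pose u : fps K := Fps (fun i => fps_coef b (i + m)).
have bE : b = fps_of_poly 'X^m * u.
  apply: fpsP => n; rewrite fps_coefM.
  have [lt_nm|le_mn] := ltnP n m.
    rewrite big1 => [|i _]; last first.
      by rewrite /= coefXn (_ : _ == m = false) ?mul0r //; have := ltn_ord i; lia.
    by apply/eqP; apply: contraTT lt_nm => bn; rewrite -leqNgt minm.
  have mP : (m < n.+1)%N by [].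
  rewrite (bigD1 (Ordinal mP)) //= coefXn eqxx mul1r subnK // big1 ?addr0 // => i.
  move=> /eqP im; rewrite coefXn (_ : _ == m = false) ?mul0r //.
  by apply/eqP => im'; apply: im; apply: val_inj.
have uU : u \is a GRing.unit by rewrite unfold_in /= /fps_unit /= add0n.
exists (m, a / u) => /=.
rewrite /laurent_t -tofracXn -rmorphXn bE !tofracM (rmorphV (@FracField.tofrac _) uU).
by rewrite invfM mulrA mulrAC.
Qed.

Definition laurent_repr f : nat * fps K := sval (cid (laurent_shift f)).

End Laurent.

(* Writing f = t^-m g with g in C[[t]], the value at x is x^-m (g_0 + g_1 x + ...).
   C carries its usual topology under the name R[i]^o. *)
Definition laurent_eval (R : realType) (f : laurent R[i]) (x : R) : R[i] :=
  let: (m, g) := laurent_repr f in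
  limn (series (fun k => fps_coef g k * x%:C ^+ k) : nat -> R[i]^o) / x%:C ^+ m.

Definition eval_mx (R : realType) n (A : 'M[laurent R[i]]_n) (x : R) : 'M[R[i]]_n :=
  map_mx (fun f => laurent_eval f x) A.

(** * Invariant factors *)

(* v lists the invariant factors of A, in any order. *)
Definition invariant_factors (K : fieldType) n (A : 'M[laurent K]_n)
    (v : 'I_n -> int) : Prop :=
  exists A1 A2 : 'M[fps K]_n, [/\ A1 \in unitmx, A2 \in unitmx &
    A = map_mx (@FracField.tofrac _) A1 *m diag_mx (\row_i laurent_t K ^ v i)
        *m map_mx (@FracField.tofrac _) A2].

(** * Singular values *)

Section SingularValues.
Variable R : realType.
Local Open Scope sesquilinear_scope.
Local Notation C := R[i].
Implicit Types n : nat.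

Definition psdmx n (S : 'M[C]_n) : Prop :=
  S \is hermsymmx /\ forall u : 'rV[C]_n, 0 <= (u *m S *m u ^t*) 0 0.

(* The unique positive semidefinite square root of a positive semidefinite B;
   sqrtmxP gives existence. *)
Definition sqrtmx n (B : 'M[C]_n) : 'M[C]_n :=
  xget 0 [set S : 'M[C]_n | psdmx S /\ S *m S = B].

(* The roots of the characteristic polynomial, with multiplicity. *)
Definition eigenvalues n (B : 'M[C]_n) : seq C :=
  sval (closed_field_poly_normal (char_poly B)).

(* In increasing order; taking real parts loses nothing, the eigenvalues of a
   positive semidefinite matrix being real. *)
Definition singular_values n (M : 'M[C]_n) : seq R :=
  sort <=%R [seq complex.Re z | z <- eigenvalues (sqrtmx (M *m M ^t*))].

Lemma psdmx_mul_adj n (M : 'M[C]_n) : psdmx (M *m M ^t*).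
Proof.
split=> [|u].
  by apply/is_hermitianmxP; rewrite expr0 scale1r trmx_mul map_mxM /= trmxCK.
rewrite mulmxA -mulmxA.
have -> : M ^t* *m u ^t* = (u *m M) ^t* by rewrite trmx_mul map_mxM.
rewrite mxE sumr_ge0 // => i _.
by rewrite 2![in X in _ * X]mxE mul_conjC_ge0.
Qed.

Lemma sqrtmxP n (B : 'M[C]_n) : psdmx B ->
  psdmx (sqrtmx B) /\ sqrtmx B *m sqrtmx B = B.
Proof.
move=> [Bh Bp]; pose P := spectralmx B; pose d := spectral_diag B.
have Pu : P \is unitarymx by exact: spectral_unitarymx.
have PP : P *m P ^t* = 1%:M by exact/unitarymxP.
have PP' : P ^t* *m P = 1%:M by rewrite -invmx_unitary // mulVmx // unitarymx_unit.
have BE : B = P ^t* *m diag_mx d *m P.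
  have /orthomx_spectralP := hermitian_normalmx Bh.
  by rewrite -/P -/d invmx_unitary.
have d_ge0 i : 0 <= d 0 i.
  suff -> : d 0 i = (row i P *m B *m (row i P) ^t*) 0 0 by exact: Bp.
  have -> : d 0 i = (P *m B *m P ^t*) i i.
    rewrite BE !mulmxA PP mul1mx -mulmxA PP mulmx1.
    by rewrite mxE eqxx mulr1n.
  rewrite -row_mul [LHS]mxE [RHS]mxE; apply: eq_bigr => j _.
  by congr (_ * _); rewrite !mxE.
pose e : 'rV[C]_n := \row_i sqrtC (d 0 i).
have e_ge0 i : 0 <= e 0 i by rewrite mxE sqrtC_ge0.
have ee : diag_mx e *m diag_mx e = diag_mx d.
  by rewrite mulmx_diag; congr diag_mx; apply/rowP => i; rewrite !mxE -expr2 sqrtCK.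
have [] : exists S : 'M[C]_n, psdmx S /\ S *m S = B.
  exists (P ^t* *m diag_mx e *m P); split; last first.
    rewrite !mulmxA -[X in X *m _ *m _]mulmxA PP mulmx1.
    by rewrite -[X in X *m _]mulmxA ee BE.
  split=> [|u].
    apply/is_hermitianmxP; rewrite expr0 scale1r !trmx_mul !map_mxM trmxCK mulmxA.
    congr (_ *m _ *m _); rewrite tr_diag_mx map_diag_mx; congr diag_mx.
    by apply/rowP => i; rewrite [RHS]mxE /= (geC0_conj (e_ge0 i)).
  pose w := u *m P ^t*.
  have -> : u *m (P ^t* *m diag_mx e *m P) *m u ^t* = w *m diag_mx e *m w ^t*.
    by rewrite trmx_mul map_mxM trmxCK !mulmxA.
  clearbody w e; rewrite mxE sumr_ge0 // => i _.
  by rewrite mul_mx_diag !mxE mulrAC mulr_ge0 // mul_conjC_ge0.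
by move=> S BS; apply: (@xgetPex _ 0 [set S | psdmx S /\ S *m S = B]); exists S.
Qed.

Lemma size_singular_values n (M : 'M[C]_n) : size (singular_values M) = n.
Proof.
rewrite size_sort size_map /eigenvalues.
case: closed_field_poly_normal => r /= Er.
have := size_char_poly (sqrtmx (M *m M ^t*)); rewrite Er.
rewrite (monicP (char_poly_monic _)) scale1r size_prod_XsubC.
by case.
Qed.

End SingularValues.

Definition log_base (R : realType) (t x : R) : R := ln x / ln t.

(* Main.v *)
Require Import Defs.
From HB Require Import structures.
From mathcomp Require Import fingroup perm.
From mathcomp Require Import all_boot all_order all_algebra.
From mathcomp Require Import all_classical all_reals all_analysis.
From mathcomp Require Import complex zify ring lra.

Set Implicit Arguments.
Unset Strict Implicit.
Unset Printing Implicit Defensive.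

Import Order.TTheory GRing.Theory Num.Theory.
Import numFieldNormedType.Exports.

Local Open Scope classical_set_scope.
Local Open Scope complex_scope.
Local Open Scope ring_scope.

(** The singular values of A(t) are compared with the entries of a diagonal
    matrix, up to multiplicative constants that do not depend on t.

    If the series in the Smith form A = A1 tau A2 converged, A(t) would be tau(t)
    up to two factors that stay bounded near 0 together with their inverses.
    But only the entries of A are known to converge: they are algebraic, and a
    power series annihilated by a non-zero polynomial with convergent
    coefficients is convergent (convergent_root); A1 and A2 may diverge.
    The remedy is to truncate the inverse of A1 at an order N beyond all the
    exponents of tau.  With B the truncation, a matrix of polynomials, B A is
    still tau W for a matrix W of power series with the same constant term as
    A2, and W inherits convergence from B A because dividing by a power of t
    preserves it (smith_convergent).  As B and W are convergent with invertible
    constant terms, B(t) and W(t) distort norms by bounded factors near 0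
    (fps_sum_mx_bounds).

    It remains to see that B M = D W, with D diagonal, pins the singular values
    of M to the entries of D.  In an orthonormal eigenbasis of sqrt (M M^* ) the
    matrix M also acts, as far as norms of row vectors go, as a diagonal matrix
    (singular_values_diag), and the comparison of two diagonal matrices is the
    dimension count behind the Courant-Fischer principle: a space of dimension
    n - i (i counted from 0) and one of dimension i + 1 meet in a non-zero
    vector (compare_diag).  So the i-th singular value of A(t) lies between
    t ^ v_i / K and K t ^ v_i (singular_values_equiv), and a bounded factor
    disappears after division of logarithms by ln t. *)

(** * Row vectors and the comparison of diagonal matrices *)

Section RowNorm.
Variable C : numDomainType.

Definition l1 n (u : 'rV[C]_n) : C := \sum_j `|u 0 j|.

Lemma l1_ge0 n (u : 'rV[C]_n) : 0 <= l1 u.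
Proof. by apply: sumr_ge0 => j _. Qed.

Lemma l1_gt0 n (u : 'rV[C]_n) : u != 0 -> 0 < l1 u.
Proof.
move=> u0; rewrite lt_neqAle l1_ge0 andbT eq_sym; apply: contra u0.
rewrite psumr_eq0 // => /allP u0; apply/eqP/rowP => j; rewrite mxE.
by apply/eqP; rewrite -normr_eq0; exact: (implyP (u0 j (mem_index_enum j))).
Qed.

Lemma l1D n (u w : 'rV[C]_n) : l1 (u + w) <= l1 u + l1 w.
Proof.
by rewrite -big_split; apply: ler_sum => j _; rewrite mxE; exact: ler_normD.
Qed.

Lemma l1Z n c (u : 'rV[C]_n) : l1 (c *: u) = `|c| * l1 u.
Proof. by rewrite mulr_sumr; apply: eq_bigr => j _; rewrite mxE normrM. Qed.

Lemma l1_mulmx m n (u : 'rV[C]_m) (M : 'M[C]_(m, n)) b :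
  (forall i j, `|M i j| <= b) -> l1 (u *m M) <= n%:R * b * l1 u.
Proof.
move=> Mb.
have -> : n%:R * b * l1 u = \sum_(j < n) \sum_k `|u 0 k| * b.
  by rewrite sumr_const card_ord -mulr_suml -/(l1 u) -mulr_natl; ring.
apply: ler_sum => j _; rewrite mxE; apply: le_trans (ler_norm_sum _ _ _) _.
by apply: ler_sum => k _; rewrite normrM ler_wpM2l.
Qed.

Lemma l1_mul_diag_le n (u e : 'rV[C]_n) b :
  (forall j, u 0 j != 0 -> `|e 0 j| <= b) -> l1 (u *m diag_mx e) <= b * l1 u.
Proof.
move=> eb; rewrite mulr_sumr; apply: ler_sum => j _.
rewrite mul_mx_diag mxE normrM mulrC; have [->|u0] := eqVneq (u 0 j) 0.
  by rewrite normr0 !mulr0.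
by rewrite ler_wpM2r // eb.
Qed.

Lemma l1_mul_diag_ge n (u e : 'rV[C]_n) a :
  (forall j, u 0 j != 0 -> a <= `|e 0 j|) -> a * l1 u <= l1 (u *m diag_mx e).
Proof.
move=> ea; rewrite mulr_sumr; apply: ler_sum => j _.
rewrite mul_mx_diag mxE normrM mulrC; have [->|u0] := eqVneq (u 0 j) 0.
  by rewrite normr0 !mul0r.
by rewrite ler_wpM2l // ea.
Qed.

End RowNorm.

(** A row vector supported on J has #|J| free coordinates, and asking that its
    image be supported on L imposes n - #|L| linear equations. *)
Lemma exists_row_support (F : fieldType) n (X : 'M[F]_n) (J L : {set 'I_n}) :
  (n < #|J| + #|L|)%N ->
  exists u : 'rV[F]_n, [/\ u != 0, forall j, u 0 j != 0 -> j \in J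
    & forall l, (u *m X) 0 l != 0 -> l \in L].
Proof.
move=> ltn.
(* Y collects the equations, I embeds the free coordinates. *)
pose Y := \matrix_(a < #|J|, b < #|~: L|) X (enum_val a) (enum_val b).
pose I := \matrix_(a < #|J|, j < n) ((enum_val a == j)%:R : F).
have IX p (Z : 'M[F]_(n, p)) a b : (I *m Z) a b = Z (enum_val a) b.
  rewrite mxE (bigD1 (enum_val a)) //= mxE eqxx mul1r big1 ?addr0 // => j ja.
  by rewrite mxE eq_sym (negPf ja) mul0r.
have /rowV0Pn[w /sub_kermxP wY w0] : kermx Y != 0.
  rewrite -mxrank_eq0 mxrank_ker subn_eq0 -ltnNge.
  apply: leq_ltn_trans (rank_leq_col _) _.
  by have := cardsC L; rewrite card_ord => cL; lia.
exists (w *m I); split.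
- apply: contra w0 => /eqP w0; apply/eqP/rowP => a; rewrite mxE.
  have /rowP/(_ (enum_val a)) := w0; rewrite !mxE (bigD1 a) //= mxE eqxx mulr1.
  rewrite big1 ?addr0 // => b ba; rewrite mxE (inj_eq enum_val_inj) (negPf ba).
  by rewrite mulr0.
- move=> j; apply: contraNT => jJ; rewrite mxE big1 // => a _; rewrite mxE.
  case: eqP => [aj|]; last by rewrite mulr0.
  by case/negP: jJ; rewrite -aj enum_valP.
- move=> l; apply: contraNT => lL; have lL' : l \in ~: L by rewrite inE.
  rewrite -mulmxA mxE; apply/eqP.
  have /rowP/(_ (enum_rank_in lL' l)) := wY; rewrite !mxE; apply: etrans.
  by apply: eq_bigr => a _; rewrite IX mxE enum_rankK_in.
Qed.

(** One half of the Courant-Fischer argument, with bounded distortion X in place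
    of an isometry: on the vector given by exists_row_support, diag d stretches
    by at least a and diag e by at most b. *)
Lemma compare_diag (C : numFieldType) n (X : 'M[C]_n) (d e : 'rV[C]_n)
    (J L : {set 'I_n}) (a b K1 K2 : C) :
  (n < #|J| + #|L|)%N -> 0 <= b -> 0 <= K1 ->
  (forall j, j \in J -> a <= `|d 0 j|) -> (forall l, l \in L -> `|e 0 l| <= b) ->
  (forall u : 'rV_n, l1 (u *m diag_mx d) <= K1 * l1 (u *m X *m diag_mx e)) ->
  (forall u : 'rV_n, l1 (u *m X) <= K2 * l1 u) ->
  a <= K1 * K2 * b.
Proof.
move=> ltn b0 K10 aJ bL dXe XK.
have [u [u0 uJ uL]] := exists_row_support X ltn.
rewrite -(ler_pM2r (l1_gt0 u0)).
apply: le_trans (l1_mul_diag_ge (fun j uj => aJ j (uJ j uj))) _.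
apply: le_trans (dXe u) _; rewrite -!mulrA ler_wpM2l //.
apply: le_trans (l1_mul_diag_le (fun l ul => bL l (uL l ul))) _.
by rewrite mulrCA ler_wpM2l.
Qed.

(** * Singular values as stretching factors *)

Section L2Norm.
Local Open Scope sesquilinear_scope.
Variable C : numClosedFieldType.

Definition l2sq n (u : 'rV[C]_n) : C := (u *m u ^t*) 0 0.

Lemma l2sqE n (u : 'rV[C]_n) : l2sq u = \sum_j `|u 0 j| ^+ 2.
Proof. by rewrite /l2sq mxE; apply: eq_bigr => j _; rewrite !mxE normCK. Qed.

(** Equality of Euclidean norms is turned into a bound on the l1 norms, the only
    ones for which estimates are made below. *)
Lemma l1_le_l2 n p (u : 'rV[C]_n) (w : 'rV[C]_p) :
  l2sq u = l2sq w -> l1 u <= n%:R * l1 w.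
Proof.
rewrite !l2sqE => uw.
suff uj j : `|u 0 j| <= l1 w.
  apply: le_trans (ler_sum _ (fun j _ => uj j)) _.
  by rewrite sumr_const card_ord mulr_natl.
rewrite -(@ler_pXn2r _ 2) ?nnegrE ?l1_ge0 //.
apply: (@le_trans _ _ (\sum_j `|u 0 j| ^+ 2)).
  by rewrite (bigD1 j) //= lerDl sumr_ge0 // => k _; rewrite exprn_ge0.
rewrite uw expr2 {1}/l1 mulr_suml; apply: ler_sum => k _.
rewrite expr2 ler_wpM2l // /l1 (bigD1 k) //= lerDl sumr_ge0 // => i _.
Qed.

Lemma l2sq_unitary n p (u : 'rV[C]_n) (P : 'M[C]_(n, p)) :
  P \is unitarymx -> l2sq (u *m P) = l2sq u.
Proof.
move=> /unitarymxP PP; rewrite /l2sq trmx_mul map_mxM /= mulmxA -(mulmxA u) PP.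
by rewrite mulmx1.
Qed.

Lemma l2sq_unitaryC n (u : 'rV[C]_n) (P : 'M[C]_n) :
  P \is unitarymx -> l2sq (u *m P ^t*) = l2sq u.
Proof. by move=> Pu; rewrite l2sq_unitary // trmxC_unitary. Qed.

End L2Norm.

Lemma char_poly_similar (K : fieldType) n (P A B : 'M[K]_n) :
  P \in unitmx -> P *m A = B *m P -> char_poly A = char_poly B.
Proof.
move=> Pu PA; have PXu : map_mx polyC P \in unitmx.
  by rewrite unitmxE det_map_mx rmorph_unit // -unitmxE.
have : map_mx polyC P *m char_poly_mx A = char_poly_mx B *m map_mx polyC P.
  rewrite /char_poly_mx mulmxBr mulmxBl -!map_mxM PA; congr (_ - _).
  exact: scalar_mxC.
move=> /(congr1 determinant); rewrite !det_mulmx mulrC => /mulIr; apply.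
by rewrite -unitmxE.
Qed.

Section SingularValueDecomposition.
Local Open Scope sesquilinear_scope.
Variable R : realType.
Local Notation C := R[i].

Lemma eigenvalues_diag n (S P : 'M[C]_n) (d : 'rV_n) :
  P \in unitmx -> P *m S = diag_mx d *m P ->
  perm_eq (eigenvalues S) [seq d 0 i | i <- enum 'I_n].
Proof.
move=> Pu PS; rewrite /eigenvalues; case: closed_field_poly_normal => r /=.
rewrite (monicP (char_poly_monic _)) scale1r (char_poly_similar Pu PS).
rewrite (char_poly_trig (diag_mx_is_trig _)) => rE; apply: prod_XsubC_eq.
rewrite -rE big_map big_enum; apply: eq_bigr => i _.
by rewrite mxE eqxx mulr1n.
Qed.

(** A diagonalisation of sqrt (M M^* ), with its rows permuted so that the
    eigenvalues appear in increasing order.  The norm identity holds because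
    M M^* is the square of a hermitian matrix S, so that u M and u S have the
    same Euclidean norm. *)
Lemma singular_values_diag n (M : 'M[C]_n) :
  exists (P : 'M[C]_n) (d : 'rV[C]_n), [/\ P \is unitarymx,
    forall i, d 0 i = ((singular_values M)`_i)%:C,
    forall i : 'I_n, 0 <= (singular_values M)`_i
    & forall u : 'rV_n, l2sq (u *m P *m M) = l2sq (u *m diag_mx d)].
Proof.
have [[Sh Sp] SS] := sqrtmxP (psdmx_mul_adj M); rewrite /singular_values.
set S := sqrtmx _ in Sh Sp SS *.
have Sa : S ^t* = S by move/is_hermitianmxP: Sh; rewrite expr0 scale1r => <-.
pose P := spectralmx S; pose d := spectral_diag S.
have Pu : P \is unitarymx by exact: spectral_unitarymx.
have PP : P *m P ^t* = 1%:M by exact/unitarymxP.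
have PS : P *m S = diag_mx d *m P.
  have /orthomx_spectralP SE := hermitian_normalmx Sh.
  by rewrite SE -/P -/d invmx_unitary // !mulmxA PP mul1mx.
have d_ge0 i : 0 <= d 0 i.
  suff -> : d 0 i = (row i P *m S *m (row i P) ^t*) 0 0 by exact: Sp.
  have -> : d 0 i = (P *m S *m P ^t*) i i.
    by rewrite PS -mulmxA PP mulmx1 mxE eqxx mulr1n.
  rewrite -row_mul [LHS]mxE [RHS]mxE; apply: eq_bigr => j _.
  by congr (_ * _); rewrite !mxE.
set s := sort _ _.
have : perm_eq s (map_tuple (fun i => complex.Re (d 0 i)) (ord_tuple n)).
  rewrite perm_sort /= (map_comp (@complex.Re R) (d 0)).
  exact: (perm_map _ (eigenvalues_diag (unitarymx_unit Pu) PS)).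
case/tuple_permP => p sE.
have sp (i : 'I_n) : (s`_i)%:C = d 0 (p i).
  rewrite sE -tnth_nth !tnth_mktuple.
  by rewrite RRe_real // ger0_real.
have pPu : row_perm p P \is unitarymx.
  apply/unitarymxP.
  rewrite row_permE trmx_mul map_mxM tr_perm_mx map_perm_mx mulmxA -(mulmxA _ P) PP.
  by rewrite mulmx1 -perm_mxM mulgV perm_mx1.
exists (row_perm p P), (\row_i d 0 (p i)); split=> // [i|i|u].
- by rewrite mxE sp.
- by rewrite -lecR sp.
have PS' : row_perm p P *m S = diag_mx (\row_i d 0 (p i)) *m row_perm p P.
  rewrite !row_permE -mulmxA PS !mulmxA; congr (_ *m _); apply/matrixP => i j.
  rewrite mul_mx_diag mul_diag_mx !mxE; case: eqP => [<-|]; first exact: mulrC.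
  by rewrite mulr0 mul0r.
have -> : l2sq (u *m row_perm p P *m M) = l2sq (u *m row_perm p P *m S).
  by rewrite /l2sq !trmx_mul !map_mxM /= !mulmxA Sa -!(mulmxA (u *m _)) SS.
by rewrite -mulmxA PS' mulmxA l2sq_unitary.
Qed.
End SingularValueDecomposition.

(** * Power series: powers of t and truncated majorants *)

Section FpsShift.
Variable K : fieldType.
Implicit Types f g : fps K.

Local Notation "f `[ i ]" := (fps_coef f i) (at level 2, format "f `[ i ]").
Local Notation T := (fps_of_poly 'X : fps K).

Lemma fps_coef0 i : (0 : fps K)`[i] = 0.
Proof. by rewrite /= coef0. Qed.

Lemma fps_coefD f g i : (f + g)`[i] = f`[i] + g`[i].
Proof. by []. Qed.

Lemma fps_coefN f i : (- f)`[i] = - f`[i].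
Proof. by []. Qed.

Lemma fps_coefMn f n i : (f *+ n)`[i] = f`[i] *+ n.
Proof. by elim: n => [|n IH]; rewrite ?fps_coef0 // !mulrS fps_coefD IH. Qed.

Lemma fps_coef0M f g : (f * g)`[0] = f`[0] * g`[0].
Proof. by rewrite fps_coefM big_ord1. Qed.

Lemma fps_coefTM f n : (T * f)`[n] = if n is m.+1 then f`[m] else 0.
Proof.
case: n => [|n]; first by rewrite fps_coef0M /= coefX mul0r.
rewrite fps_coefM big_ord_recl /= coefX mul0r add0r big_ord_recl /= coefX mul1r.
by rewrite subn1 /= big1 ?addr0 // => i _; rewrite coefX mul0r.
Qed.

Lemma fps_coefTnM k f n : (T ^+ k * f)`[n] = if (n < k)%N then 0 else f`[n - k].
Proof.
elim: k n => [|k IH] n; first by rewrite expr0 mul1r subn0.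
by rewrite exprS -mulrA fps_coefTM; case: n => [|n] //; rewrite IH ltnS subSS.
Qed.

Lemma fps_T_neq0 : T != 0.
Proof.
by rewrite -(rmorph0 (@fps_of_poly K)) (inj_eq (@fps_of_poly_inj K)) polyX_eq0.
Qed.

Definition fps_drop N f : fps K := Fps (fun i => f`[i + N]).

Lemma fps_split N f : f = fps_of_poly (fps_trunc N f) + T ^+ N * fps_drop N f.
Proof.
apply: fpsP => i; rewrite fps_coefD fps_coefTnM /= coef_poly.
by case: ltnP => iN; rewrite ?addr0 // subnK // add0r.
Qed.

Lemma fps_dropE N f : (forall i, (i < N)%N -> f`[i] = 0) ->
  f = T ^+ N * fps_drop N f.
Proof.
move=> f0; apply: fpsP => i; rewrite fps_coefTnM /=.
by case: ltnP => iN; [exact: f0|rewrite subnK].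
Qed.

End FpsShift.

Section TruncatedNorm.
Variable K : numFieldType.
Implicit Types (f g : fps K) (r M : K) (N : nat).

Local Notation "f `[ i ]" := (fps_coef f i) (at level 2, format "f `[ i ]").
Local Notation T := (fps_of_poly 'X : fps K).

(** Partial sum of the majorant series at r.  Working with all partial sums at
    once avoids limits, and N.+1 against N in pnormTM is what makes the
    induction of convergent_fixpoint progress. *)
Definition pnorm N r f : K := \sum_(i < N) `|f`[i]| * r ^+ i.

Lemma pnorm_ge0 N r f : 0 <= r -> 0 <= pnorm N r f.
Proof. by move=> r0; apply: sumr_ge0 => i _; rewrite mulr_ge0 ?exprn_ge0. Qed.

Lemma pnormD N r f g : 0 <= r -> pnorm N r (f + g) <= pnorm N r f + pnorm N r g.
Proof.
move=> r0; rewrite -big_split; apply: ler_sum => i _ /=.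
by rewrite -mulrDl ler_wpM2r ?exprn_ge0 // ler_normD.
Qed.

Lemma pnormN N r f : pnorm N r (- f) = pnorm N r f.
Proof. by apply: eq_bigr => i _; rewrite fps_coefN normrN. Qed.

(** Both factors are majorised by polynomials, for which evaluation at r is
    multiplicative; the product of the truncations has non-negative further
    terms. *)
Lemma pnormM N r f g : 0 <= r -> pnorm N r (f * g) <= pnorm N r f * pnorm N r g.
Proof.
move=> r0; pose p f : {poly K} := \poly_(i < N) `|f`[i]|.
have pE h : pnorm N r h = (p h).[r] by rewrite horner_poly.
have p0 h i : 0 <= (p h)`_i by rewrite coef_poly; case: ifP.
have szp : (size (p f * p g)%R <= N + N)%N.
  apply: leq_trans (size_polyMleq _ _) _; apply: leq_trans (leq_pred _) _.
  by rewrite leq_add ?size_poly.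
rewrite !pE -hornerM (horner_coef_wide _ szp) big_split_ord /= -pE.
rewrite -[leLHS]addr0; apply: lerD; last first.
  apply: sumr_ge0 => i _; rewrite mulr_ge0 ?exprn_ge0 // coefM sumr_ge0 // => j _.
  exact: mulr_ge0.
apply: ler_sum => i _; rewrite ler_wpM2r ?exprn_ge0 // fps_coefM coefM.
apply: le_trans (ler_norm_sum _ _ _) _; apply: ler_sum => j _.
have := ltn_ord i; have := ltn_ord j => ji iN.
by rewrite normrM !coef_poly (_ : (j < N)%N) 1?(_ : (i - j < N)%N) //; lia.
Qed.

Lemma pnorm_le N r r' f : 0 <= r -> r <= r' -> pnorm N r f <= pnorm N r' f.
Proof.
move=> r0 rr'; apply: ler_sum => i _; rewrite ler_wpM2l //.
by rewrite lerXn2r // nnegrE // (le_trans r0).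
Qed.

Lemma pnormTM N r f : pnorm N.+1 r (T * f) = r * pnorm N r f.
Proof.
rewrite /pnorm big_ord_recl fps_coefTM normr0 mul0r add0r mulr_sumr.
by apply: eq_bigr => i _; rewrite fps_coefTM /= exprS mulrCA.
Qed.

Lemma pnormTnM k N r f : pnorm (k + N) r (T ^+ k * f) = r ^+ k * pnorm N r f.
Proof.
elim: k => [|k IH]; first by rewrite !expr0 !mul1r.
by rewrite !exprS -!mulrA addSn pnormTM IH.
Qed.

Lemma pnorm_poly N r (p : {poly K}) : 0 <= r ->
  pnorm N r (fps_of_poly p) <= \sum_(i < size p) `|p`_i| * r ^+ i.
Proof.
move=> r0; rewrite [leRHS](big_ord_widen (size p + N) (fun i => `|p`_i| * r ^+ i)).
  rewrite big_mkcond /pnorm.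
  rewrite (big_ord_widen (size p + N) (fun i => `|(fps_of_poly p)`[i]| * r ^+ i)).
    rewrite [leLHS]big_mkcond; apply: ler_sum => i _ /=.
    have [_|] := ltnP i (size p); first by case: ifP => // _; rewrite mulr_ge0 ?exprn_ge0.
    by move=> pi; rewrite nth_default // normr0 mul0r; case: ifP.
  by rewrite leq_addl.
by rewrite leq_addr.
Qed.

Lemma pnorm_horner N r M (G : {poly fps K}) g d : 0 <= r -> pnorm N r g <= d ->
  (forall i, pnorm N r G`_i <= M) -> 0 <= M ->
  pnorm N r G.[g] <= \sum_(i < size G) M * d ^+ i.
Proof.
move=> r0 gd GM M0; have d0 : 0 <= d := le_trans (pnorm_ge0 N g r0) gd.
rewrite horner_coef.
elim: (size G) => [|n IH].
  rewrite !big_ord0 /pnorm big1 // => i _; by rewrite fps_coef0 normr0 mul0r.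
rewrite !big_ord_recr /=; apply: le_trans (pnormD _ _ _ r0) _; apply: lerD => //.
apply: le_trans (pnormM _ _ _ r0) _; apply: ler_pM => //; try exact: pnorm_ge0.
elim: (n) => [|k IHk].
  rewrite !expr0 /pnorm; case: (N) => [|N']; first by rewrite big_ord0.
  rewrite big_ord_recl big1 => [|i _]; last by rewrite /= coefC /= normr0 mul0r.
  by rewrite /= coefC eqxx normr1 mulr1 addr0.
rewrite !exprS; apply: le_trans (pnormM _ _ _ r0) _.
by apply: ler_pM => //; exact: pnorm_ge0.
Qed.

End TruncatedNorm.

(** * Convergent power series and their algebraic closure *)

Section Convergent.
Variable K : numFieldType.
Implicit Types (f g : fps K) (r M : K) (N : nat).

Local Notation "f `[ i ]" := (fps_coef f i) (at level 2, format "f `[ i ]").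
Local Notation T := (fps_of_poly 'X : fps K).

Definition convergent : {pred fps K} :=
  fun f => `[< exists r M, 0 < r /\ forall N, pnorm N r f <= M >].

Lemma convergentP f :
  reflect (exists r M, 0 < r /\ forall N, pnorm N r f <= M) (f \in convergent).
Proof. exact: asboolP. Qed.

(** The order on K is only partial, so that the minimum is replaced by half of
    the harmonic mean. *)
Lemma common_radius r1 r2 : 0 < r1 -> 0 < r2 ->
  exists r, [/\ 0 < r, r <= r1 & r <= r2].
Proof.
move=> r10 r20; have r12 := addr_gt0 r10 r20.
exists (r1 * r2 / (r1 + r2)); split; first by rewrite divr_gt0 ?mulr_gt0.
  by rewrite ler_pdivrMr // ler_pM2l // lerDr ltW.
by rewrite ler_pdivrMr // mulrC ler_pM2l // lerDl ltW.
Qed.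

Lemma convergent_uniform (s : seq (fps K)) : {subset s <= convergent} ->
  exists r M, [/\ 0 < r, 0 <= M & forall f, f \in s -> forall N, pnorm N r f <= M].
Proof.
elim: s => [_|f s IH sc]; first by exists 1, 0; split.
have [g gs|r1 [M1 [r10 M10 sM]]] := IH; first by rewrite sc // inE gs orbT.
have /convergentP[r2 [M2 [r20 fM]]] := sc f (mem_head _ _).
have [r [r0 rr1 rr2]] := common_radius r10 r20.
have M20 : 0 <= M2 := le_trans (pnorm_ge0 0 f (ltW r20)) (fM 0%N).
exists r, (M1 + M2); split=> //; first exact: addr_ge0.
move=> g; rewrite inE => /predU1P[->|gs] N.
  by apply: le_trans (pnorm_le _ _ (ltW r0) rr2) (le_trans (fM _) _); rewrite lerDr.
apply: le_trans (pnorm_le _ _ (ltW r0) rr1) (le_trans (sM _ gs _) _).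
by rewrite lerDl.
Qed.

Lemma convergent_poly (p : {poly K}) : fps_of_poly p \in convergent.
Proof.
apply/convergentP; exists 1; eexists; split=> // N.
exact: pnorm_poly ler01.
Qed.

Fact convergent_subring : subring_closed convergent.
Proof.
have two f g : f \in convergent -> g \in convergent ->
    exists r M, [/\ 0 < r, 0 <= M, forall N, pnorm N r f <= M
                 & forall N, pnorm N r g <= M].
  move=> fc gc; have [|r [M [r0 M0 sM]]] := @convergent_uniform [:: f; g].
    by move=> h; rewrite in_cons mem_seq1 => /orP[]/eqP->.
  by exists r, M; split=> // N; apply: sM; rewrite !inE eqxx ?orbT.
split; first exact: (convergent_poly 1).
- move=> f g fc gc; have [r [M [r0 M0 fM gM]]] := two f g fc gc.
  apply/convergentP; exists r, (M + M); split=> // N.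
  apply: le_trans (pnormD _ _ _ (ltW r0)) _.
  by apply: lerD; [exact: fM|rewrite pnormN; exact: gM].
- move=> f g fc gc; have [r [M [r0 M0 fM gM]]] := two f g fc gc.
  apply/convergentP; exists r, (M * M); split=> // N.
  apply: le_trans (pnormM _ _ _ (ltW r0)) _.
  by apply: ler_pM; rewrite ?pnorm_ge0 // ltW.
Qed.
HB.instance Definition _ :=
  GRing.isSubringClosed.Build (fps K) convergent convergent_subring.

Lemma convergent_divT k f : T ^+ k * f \in convergent -> f \in convergent.
Proof.
move=> /convergentP[r [M [r0 fM]]]; apply/convergentP.
exists r, (M / r ^+ k); split=> // N.
by rewrite ler_pdivlMr ?exprn_gt0 // mulrC -pnormTnM.
Qed.

Lemma convergent_drop k f : f \in convergent -> fps_drop k f \in convergent.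
Proof.
move=> fc; apply: (@convergent_divT k).
have -> : T ^+ k * fps_drop k f = f - fps_of_poly (fps_trunc k f).
  by rewrite {2}[f](fps_split k) addrC addKr.
by rewrite rpredB // convergent_poly.
Qed.

(** The factor t makes the coefficients of g up to order N + 1 depend only on
    those of G and on those of g up to order N.  Hence, as soon as the radius r
    is so small that r times the majorant of G at M + 1 is at most 1, the bound
    M + 1 on the majorant of g propagates from N to N + 1. *)
Lemma convergent_fixpoint (a g : fps K) (G : {poly fps K}) :
  a \in convergent -> G \is a polyOver convergent ->
  g = a + T * G.[g] -> g \in convergent.
Proof.
move=> ac Gc gE; have [f|r0 [M [r00 M0 sM]]] := @convergent_uniform (a :: G).
  by rewrite inE => /predU1P[->//|]; exact: (allP Gc).
pose B := \sum_(i < size G) M * (M + 1) ^+ i.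
have M1 : 0 <= M + 1 by rewrite addr_ge0.
have B0 : 0 <= B by apply: sumr_ge0 => i _; rewrite mulr_ge0 ?exprn_ge0.
have rB : 0 < 1 + r0 * B by rewrite ltr_wpDr // mulr_ge0 // ltW.
(* This r satisfies both r <= r0 and r * B <= 1. *)
pose r := r0 / (1 + r0 * B).
have r_gt0 : 0 < r by rewrite divr_gt0.
have r_ge0 := ltW r_gt0.
have rr0 : r <= r0.
  by rewrite ler_pdivrMr // ler_peMr ?(ltW r00) // lerDl mulr_ge0 // ltW.
apply/convergentP; exists r, (M + 1); split=> // N.
elim: N => [|N IH]; first by rewrite /pnorm big_ord0.
rewrite gE; apply: le_trans (pnormD _ _ _ r_ge0) _; apply: lerD.
  by apply: le_trans (pnorm_le _ _ r_ge0 rr0) (sM _ (mem_head _ _) _).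
rewrite pnormTM; apply: (@le_trans _ _ (r * B)).
  rewrite ler_wpM2l //; apply: pnorm_horner => // i.
  apply: le_trans (pnorm_le _ _ r_ge0 rr0) _.
  have [iG|Gi] := ltnP i (size G); first by rewrite sM // inE mem_nth ?orbT.
  rewrite nth_default // /pnorm big1 // => j _.
  by rewrite fps_coef0 normr0 mul0r.
by rewrite /r mulrAC ler_pdivrMr // mul1r lerDr.
Qed.

End Convergent.

Lemma horner_taylor2 (D : comNzRingType) (P : {poly D}) (p h : D) :
  P.[p + h] = P.[p] + P^`().[p] * h
    + h ^+ 2 * (\poly_(i < size P) P^`N(i.+2).[p]).[h].
Proof.
rewrite (@nderiv_taylor_wide _ (size P).+2) ?(leqW (leqW _)) //; last exact: mulrC.
rewrite 2!big_ord_recl /= nderivn0 nderivn1 !expr0 mulr1 expr1 -addrA.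
congr (_ + (_ + _)); rewrite horner_poly mulr_sumr; apply: eq_bigr => i _.
by rewrite /bump /= !add1n !exprS; ring.
Qed.

Section AlgebraicConvergent.
Variable K : numFieldType.
Local Notation "f `[ i ]" := (fps_coef f i) (at level 2, format "f `[ i ]").
Local Notation T := (fps_of_poly 'X : fps K).
Local Notation convergent := (@convergent K).

Lemma fps_deriv_neq0 (P : {poly fps K}) : (1 < size P)%N -> P^`() != 0.
Proof.
move=> P1; apply: contraTneq P1 => P0; rewrite -leqNgt.
apply/leq_sizeP => j j0; case: j j0 => // j _.
have /polyP/(_ j) := P0; rewrite coef_deriv coef0 => Pj.
apply: fpsP => i; rewrite fps_coef0.
have /(congr1 (fun f => f`[i])) := Pj; rewrite fps_coefMn fps_coef0.
by move=> /eqP; rewrite mulrn_eq0 /= => /eqP.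
Qed.

(** Newton's method.  Let k be the order of P'(f) and f = p + t^(k+1) g with p a
    polynomial.  Taylor's formula at p divided by t^(2k+1) reads
    0 = - a + b g + t g^2 Q(g), where a, b and Q are convergent and b has a
    non-zero constant term b0.  Solving for b0 g gives a fixed point equation of
    the form treated by convergent_fixpoint. *)
Lemma convergent_simple_root (P : {poly fps K}) f :
  P \is a polyOver convergent -> root P f -> P^`().[f] != 0 -> f \in convergent.
Proof.
move=> Pc /rootP Pf e0; case: (ex_minnP (fps_val_ex e0)) => k ek mink.
pose p := fps_of_poly (fps_trunc k.+1 f); pose g := fps_drop k.+1 f.
have pc : p \in convergent by exact: convergent_poly.
have fE : f = p + T ^+ k.+1 * g by exact: fps_split.
have hc (Q : {poly fps K}) : Q \is a polyOver convergent -> Q.[p] \in convergent.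
  by move=> Qc; rewrite rpred_horner.
have dPc := polyOver_deriv Pc.
pose b := fps_drop k P^`().[p].
(* P'(p) and P'(f) agree modulo t^(k+1), so they have the same order. *)
have eE i : (i <= k)%N -> P^`().[p]`[i] = P^`().[f]`[i].
  move=> ik; rewrite {1}fE horner_taylor2 -addrA exprMn -!mulrA mulrCA.
  rewrite -mulrDr.
  by rewrite fps_coefD fps_coefTnM ltnS ik addr0.
have bE : P^`().[p] = T ^+ k * b.
  apply: fps_dropE => i ik; rewrite eE ?(ltnW ik) //.
  by apply/eqP; apply: contraTT ik => fi; rewrite -leqNgt mink.
have b0 : b`[0] != 0 by rewrite /= eE.
pose Q := \poly_(i < size P) (P^`N(i.+2).[p] * (T ^+ k.+1) ^+ i).
have Qc : Q \is a polyOver convergent.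
  apply/polyOverP => i; rewrite coef_poly; case: ifP => _; last exact: rpred0.
  rewrite rpredM ?rpredX ?convergent_poly // hc //; exact: polyOver_nderivn.
have QE : (\poly_(i < size P) P^`N(i.+2).[p]).[T ^+ k.+1 * g] = Q.[g].
  by rewrite !horner_poly; apply: eq_bigr => i _; rewrite exprMn mulrA.
pose a := b * g + T * (g ^+ 2 * Q.[g]).
have ac : a \in convergent.
  apply: (@convergent_divT _ (k + k.+1)); rewrite -[_ * a]opprK rpredN.
  suff <- : P.[p] = - (T ^+ (k + k.+1) * a) by exact: hc.
  apply/eqP; rewrite -subr_eq0 opprK; move: Pf; rewrite {1}fE horner_taylor2 QE bE => <-.
  rewrite /a exprD !exprS; move: (T) (T ^+ k) => t tk; by apply/eqP; ring.
have bc : b \in convergent by apply/convergent_drop/hc.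
pose c := fps_of_poly (b`[0]^-1)%:P.
have cc : c \in convergent by exact: convergent_poly.
pose b1 := fps_drop 1 b.
have b1c : b1 \in convergent by exact: convergent_drop.
(* b / b0 = 1 + t b1 / b0; the part in t moves to the right-hand side. *)
have cb : c * b = 1 + T * (c * b1).
  rewrite [b in LHS](fps_split 1) expr1 mulrDr mulrCA; congr (_ + _).
  rewrite /c -rmorphM /= -(rmorph1 (@fps_of_poly K)); congr fps_of_poly.
  rewrite (_ : fps_trunc 1 b = b`[0]%:P); first by rewrite -polyCM mulVf.
  by apply/polyP => i; rewrite coef_poly coefC; case: i.
rewrite fE rpredD // rpredM ?rpredX ?convergent_poly //.
apply: (@convergent_fixpoint _ (c * a) _ (- c *: (b1 *: 'X + 'X^2 * Q))).
- by rewrite rpredM.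
- rewrite polyOverZ ?rpredN // rpredD ?rpredM ?polyOverZ ?polyOverX ?polyOverXn //.
rewrite hornerZ hornerD hornerM hornerZ hornerX hornerXn.
have -> : c * a = c * b * g + T * c * (g ^+ 2 * Q.[g]) by rewrite /a; ring.
by rewrite cb; ring.
Qed.

(** In characteristic zero a multiple root of P is a root of the non-zero
    polynomial P', which has smaller degree. *)
Lemma convergent_root (P : {poly fps K}) f :
  P \is a polyOver convergent -> P != 0 -> root P f -> f \in convergent.
Proof.
move: {2}(size P) (leqnn (size P)) => n; elim: n P => [|n IH] P.
  by rewrite leqn0 size_poly_eq0 => -> .
move=> Pn Pc P0 Pf; have [Pf'|] := eqVneq P^`().[f] 0; last exact: convergent_simple_root.
have P1 := root_size_gt1 P0 Pf.
apply: (IH P^`()); rewrite ?polyOver_deriv ?fps_deriv_neq0 //; last exact/rootP.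
by rewrite -ltnS; apply: leq_trans (lt_size_deriv P0) Pn.
Qed.

End AlgebraicConvergent.

Lemma clear_denominators (D : idomainType) (q : {poly {fraction D}}) :
  exists (c : D) (p : {poly D}), c != 0 /\
    c%:F *: q = map_poly (@FracField.tofrac D) p.
Proof.
elim/poly_ind: q => [|q a [c [p [c0 cq]]]].
  by exists 1, 0; rewrite oner_neq0 scaler0 rmorph0.
have d0 := denom_ratioP (repr a).
exists ((repr a).2 * c), ((repr a).2 *: p * 'X + (c * (repr a).1)%:P); split.
  by rewrite mulf_neq0.
rewrite rmorphD [X in _ = X + _]rmorphM /= map_polyX map_polyC /= map_polyZ /= -cq.
rewrite !tofracM.
rewrite scalerDr -!scalerAl scalerA; congr (_ + _).
rewrite -mul_polyC -polyCM {2}[a]frac_numden; congr _%:P; field.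
by rewrite tofrac_eq0.
Qed.

Lemma laurent_of_ratfun_poly (K : fieldType) (c : {poly K}) :
  laurent_of_ratfun c%:F = (fps_of_poly c)%:F.
Proof.
have -> : c%:F = c%:F / 1%:F :> ratfun K by rewrite tofrac1 divr1.
by rewrite laurent_of_ratfunE ?oner_neq0 // !rmorph1 divr1.
Qed.

(** Denominators are cleared so that the equation of g has polynomial, hence
    convergent, coefficients. *)
Lemma convergent_algebraic (K : numFieldType) (g : fps K) :
  algebraicOver (@laurent_of_ratfun K) g%:F -> g \in @convergent K.
Proof.
move=> [q q0 /rootP qg]; have [c [p [c0 cq]]] := clear_denominators q.
pose P := map_poly (@fps_of_poly K) p.
apply: (@convergent_root _ P).
- by apply/polyOverP => i; rewrite coef_map; exact: convergent_poly.
- rewrite -(rmorph0 (map_poly (@fps_of_poly K))).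
  rewrite (inj_eq (map_inj_poly (@fps_of_poly_inj K) (rmorph0 _))).
  apply: contraNneq q0 => p0; move/eqP: cq.
  by rewrite p0 rmorph0 scale_poly_eq0 tofrac_eq0 (negPf c0).
apply/rootP/eqP; rewrite -(tofrac_eq0 (P.[g])) -horner_map -map_poly_comp /=.
rewrite (@eq_map_poly _ _ _ (laurent_of_ratfun (K := K) \o @FracField.tofrac _));
  last first.
  by move=> x /=; rewrite laurent_of_ratfun_poly.
rewrite map_poly_comp /= -cq -mul_polyC rmorphM /= map_polyC hornerM.
by rewrite qg mulr0.
Qed.

(** * Sums of convergent power series at small positive reals *)

Section ComplexSeries.
Variable R : realType.
Local Notation C := R[i].

Lemma normc_real (x : R) : `|x%:C| = `|x|%:C.
Proof. by rewrite normc_def /= expr0n addr0 sqrtr_sqr. Qed.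

Lemma normci : `|'i%C : C| = 1.
Proof. by rewrite normc_def /= expr0n add0r expr1n sqrtr1. Qed.

Lemma normc_le_ReIm (z : C) : `|z| <= (`|complex.Re z| + `|complex.Im z|)%:C.
Proof.
rewrite {1}(complexE z) rmorphD /=; apply: le_trans (ler_normD _ _) _.
by rewrite normrM normci mul1r !normc_real.
Qed.

Lemma ReD : {morph @complex.Re R : a b / a + b}.
Proof. by case=> [a b] [c d]. Qed.

Lemma ImD : {morph @complex.Im R : a b / a + b}.
Proof. by case=> [a b] [c d]. Qed.

(** Completeness of R applied to the real and imaginary parts. *)
Lemma cvg_complex_series (u : nat -> C) (M : C) :
  (forall N, \sum_(i < N) `|u i| <= M) -> cvgn (series u : nat -> R[i]^o).
Proof.
move=> uM.
have part (p : C -> R) : {morph p : a b / a + b} -> p 0 = 0 ->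
    (forall z, `|p z|%:C <= `|z|) -> cvgn (series (p \o u)).
  move=> pD p0 pz; apply: (@normed_cvg _ R^o).
  apply: nondecreasing_is_cvgn; first by
    apply: nondecreasing_series => *; exact: normr_ge0.
  exists (complex.Re M) => _ [N _ <-]; rewrite -lecR.
  have M_real : M \is Num.real.
    by rewrite ger0_real //; apply: le_trans (uM 0%N); rewrite big_ord0.
  rewrite RRe_real //; apply: le_trans (uM N).
  have -> : [normed series (p \o u)] N = \sum_(i < N) `|p (u i)| by exact: big_mkord.
  by rewrite rmorph_sum; apply: ler_sum => i _; exact: pz.
have ReC := part (@complex.Re R) ReD erefl (@normc_ge_Re R).
have ImC : cvgn (series (@complex.Im R \o u)).
  apply: part => // [|z]; first exact: ImD.
  by have := normc_ge_Re (z * 'i%C); rewrite ReiNIm normrN normrM normci mulr1.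
pose a := limn (series (@complex.Re R \o u)).
pose b := limn (series (@complex.Im R \o u)).
apply: (cvgP ((a +i* b)%C : R[i]^o)); apply/cvgrPdist_le => e e0.
have eE : e = (complex.Re e)%:C by rewrite RRe_real // gtr0_real.
have e20 : 0 < complex.Re e / 2 by rewrite divr_gt0 // -ltcR -eE.
move/cvgrPdist_le: ReC => /(_ _ e20) ReC; move/cvgrPdist_le: ImC => /(_ _ e20) ImC.
near=> N.
have sE (p : C -> R) : {morph p : a b / a + b} -> p 0 = 0 ->
    series (p \o u) N = p (series u N).
  by move=> pD p0; rewrite /series /= (big_morph p pD p0).
apply: le_trans (normc_le_ReIm _) _; rewrite eE lecR [leRHS]splitr.
apply: lerD.
  rewrite ReD [complex.Re (- _)](_ : _ = - complex.Re (series u N));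
    last by case: (series u N).
  rewrite -(sE _ ReD) //; near: N; exact: ReC.
rewrite ImD [complex.Im (- _)](_ : _ = - complex.Im (series u N));
    last by case: (series u N).
rewrite -(sE _ ImD) //; near: N; exact: ImC.
Unshelve. all: by end_near. Qed.

End ComplexSeries.

Section FpsSum.
Variable R : realType.
Local Notation C := R[i].
Implicit Types (f g : fps C) (x : R) (l : C).
Local Notation "f `[ i ]" := (fps_coef f i) (at level 2, format "f `[ i ]").
Local Notation T := (fps_of_poly 'X : fps C).

Definition fps_terms f x : nat -> R[i]^o := fun k => f`[k] * x%:C ^+ k.

Definition fps_sum f x : C := limn (series (fps_terms f x)).

Definition has_fps_sum f x l := series (fps_terms f x) @ \oo --> (l : R[i]^o).

Lemma has_fps_sumE f x l : has_fps_sum f x l -> fps_sum f x = l.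
Proof. by move=> fl; exact: (cvg_lim (@norm_hausdorff _ R[i]^o) fl). Qed.

Lemma has_fps_sumD f g x l l' : has_fps_sum f x l -> has_fps_sum g x l' ->
  has_fps_sum (f + g) x (l + l').
Proof.
move=> fl gl; rewrite /has_fps_sum.
have -> : series (fps_terms (f + g) x)
    = fun N => series (fps_terms f x) N + series (fps_terms g x) N.
  apply/funext => N; rewrite /series /= -big_split; apply: eq_bigr => k _.
  by rewrite /fps_terms fps_coefD mulrDl.
exact: (cvgD fl gl).
Qed.

Lemma has_fps_sum0 x : has_fps_sum 0 x 0.
Proof.
rewrite /has_fps_sum.
have -> : series (fps_terms 0 x) = fun=> 0.
  apply/funext => N; rewrite /series /= big1 // => k _.
  by rewrite /fps_terms fps_coef0 mul0r.
exact: cvg_cst.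
Qed.

Lemma has_fps_sum_sum (I : Type) (r : seq I) (F : I -> fps C) x (l : I -> C) :
  (forall i, has_fps_sum (F i) x (l i)) ->
  has_fps_sum (\sum_(i <- r) F i) x (\sum_(i <- r) l i).
Proof.
move=> Fl; elim: r => [|i r IH]; first by rewrite !big_nil; exact: has_fps_sum0.
rewrite (big_cons _ _ _ _ _ F) (big_cons _ _ _ _ _ l).
have H := has_fps_sumD (Fl i) IH.
exact: H.
Qed.

Lemma has_fps_sumZ c f x l : has_fps_sum f x l ->
  has_fps_sum (fps_of_poly c%:P * f) x (c * l).
Proof.
move=> fl; rewrite /has_fps_sum.
have -> : series (fps_terms (fps_of_poly c%:P * f) x)
    = fun N => c * series (fps_terms f x) N.
  apply/funext => N; rewrite /series /= mulr_sumr; apply: eq_bigr => k _.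
  rewrite /fps_terms fps_coefM big_ord_recl /= coefC eqxx subn0 big1 ?addr0.
    by rewrite mulrA.
  by move=> i _; rewrite coefC /= mul0r.
exact: cvgMl_tmp.
Qed.

Lemma has_fps_sumT f x l : has_fps_sum f x l -> has_fps_sum (T * f) x (x%:C * l).
Proof.
move=> fl; rewrite /has_fps_sum -cvg_shiftS.
have -> : [sequence series (fps_terms (T * f) x) n.+1]_n
    = fun N => x%:C * series (fps_terms f x) N.
  apply/funext => N; rewrite /series /= big_nat_recl //= {1}/fps_terms fps_coefTM.
  rewrite mul0r add0r mulr_sumr; apply: eq_bigr => k _.
  by rewrite /fps_terms fps_coefTM exprS mulrCA.
exact: cvgMl_tmp.
Qed.

(** Only products with a polynomial are ever evaluated; shifts and linear
    combinations suffice for these, without a Cauchy product. *)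
Lemma has_fps_sum_poly p f x l : has_fps_sum f x l ->
  has_fps_sum (fps_of_poly p * f) x (p.[x%:C] * l).
Proof.
move=> fl; elim/poly_ind: p => [|p c IH].
  by rewrite rmorph0 mul0r horner0 mul0r; exact: has_fps_sum0.
rewrite rmorphD rmorphM /= mulrDl hornerMXaddC mulrDl -mulrA mulrCA.
rewrite [p.[_] * _]mulrC -[in X in has_fps_sum _ _ X]mulrA.
by apply: has_fps_sumD; [exact: has_fps_sumT|exact: has_fps_sumZ].
Qed.

Lemma has_fps_sum1 x : has_fps_sum 1 x 1.
Proof.
rewrite /has_fps_sum -cvg_shiftS.
rewrite [X in X @ _](_ : _ = cst 1); first exact: cvg_cst.
apply/funext => N; rewrite /series /= big_nat_recl //= {1}/fps_terms /= coefC.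
rewrite eqxx mulr1 big1 ?addr0 // => k _.
by rewrite /fps_terms /= coefC mul0r.
Qed.

Lemma fps_sum_poly (p : {poly C}) x : fps_sum (fps_of_poly p) x = p.[x%:C].
Proof.
apply: has_fps_sumE.
by have := @has_fps_sum_poly p _ _ _ (has_fps_sum1 x); rewrite !mulr1.
Qed.

Lemma fps_sum_near f : f \in @convergent C -> exists2 M : C, 0 <= M &
  \forall x \near (0 : R)^'+, has_fps_sum f x (fps_sum f x) /\ `|fps_sum f x| <= M.
Proof.
move=> /convergentP[r [M [r0 fM]]]; exists (M + 1).
  by rewrite addr_ge0 //; apply: le_trans (fM 0%N); rewrite /pnorm big_ord0.
have rE : r = (complex.Re r)%:C by rewrite RRe_real // gtr0_real.
have r0' : 0 < complex.Re r by rewrite -ltcR -rE.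
near=> x; have x0 : 0 < x by [].
have xr : x <= complex.Re r by near: x; exact: nbhs_right_le.
have xM N : \sum_(i < N) `|fps_terms f x i| <= M.
  apply: le_trans (fM N); rewrite rE; apply: ler_sum => i _.
  rewrite /fps_terms normrM ler_wpM2l // normrX normc_real gtr0_norm //.
  by rewrite lerXn2r ?nnegrE ?lecR // ltW.
have fs : has_fps_sum f x (fps_sum f x) by exact: cvg_complex_series xM.
split=> //; move/cvgrPdist_le: (fs) => /(_ _ ltr01)[N _ /(_ N (leqnn N)) fN].
rewrite -(subrK (series (fps_terms f x) N) (fps_sum f x)) addrC.
apply: le_trans (ler_normD _ _) (lerD _ fN).
rewrite /series /= big_mkord; apply: le_trans (ler_norm_sum _ _ _) (xM N).
Unshelve. all: by end_near. Qed.

(** Continuity at 0 with a linear rate: e is the sum of (f - f(0)) / t. *)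
Lemma fps_sum_cst_near f : f \in @convergent C -> exists2 M : C, 0 <= M &
  \forall x \near (0 : R)^'+, exists2 e : C,
     fps_sum f x = f`[0] + x%:C * e & `|e| <= M.
Proof.
move=> fc; have [M M0 fM] := fps_sum_near (convergent_drop 1 fc).
exists M => //; near=> x.
have [] : has_fps_sum (fps_drop 1 f) x (fps_sum (fps_drop 1 f) x) /\
  `|fps_sum (fps_drop 1 f) x| <= M by near: x.
move=> fs fsM; exists (fps_sum (fps_drop 1 f) x) => //; apply: has_fps_sumE.
rewrite {1}(fps_split 1 f) expr1 (_ : fps_trunc 1 f = f`[0]%:P); last first.
  by apply/polyP => i; rewrite coef_poly coefC; case: i.
apply: has_fps_sumD; last exact: has_fps_sumT.
by have := @has_fps_sumZ f`[0] _ _ _ (has_fps_sum1 x); rewrite !mulr1.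
Unshelve. all: by end_near. Qed.

End FpsSum.

(** * Matrices of convergent power series near 0 *)

Section MatrixEval.
Variable R : realType.
Local Notation C := R[i].
Local Notation "f `[ i ]" := (fps_coef f i) (at level 2, format "f `[ i ]").

Definition fps_sum_mx m n (W : 'M[fps C]_(m, n)) (x : R) : 'M[C]_(m, n) :=
  map_mx (fun f => fps_sum f x) W.

Lemma fps_sum_mx_poly_mul m n p (P : 'M[{poly C}]_(m, n)) (G : 'M[fps C]_(n, p)) :
  (forall i j, G i j \in @convergent C) ->
  \forall x \near (0 : R)^'+,
    fps_sum_mx (map_mx (@fps_of_poly C) P *m G) x
    = map_mx (fun q => q.[x%:C]) P *m fps_sum_mx G x.
Proof.
move=> Gc; have Gx : \forall x \near (0 : R)^'+, forall ij : 'I_n * 'I_p,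
    has_fps_sum (G ij.1 ij.2) x (fps_sum (G ij.1 ij.2) x).
  apply: filter_forall => ij; have [M _] := fps_sum_near (Gc ij.1 ij.2).
  by apply: filterS => x [].
near=> x; apply/matrixP => i j; rewrite [LHS]mxE [RHS]mxE; apply: has_fps_sumE.
rewrite mxE.
have -> : \sum_k (map_mx (fun q => q.[x%:C]) P) i k * (fps_sum_mx G x) k j
    = \sum_k (P i k).[x%:C] * fps_sum (G k j) x.
  by apply: eq_bigr => k _; rewrite !mxE.
have -> : \sum_k (map_mx (@fps_of_poly C) P) i k * G k j
    = \sum_k fps_of_poly (P i k) * G k j.
  by apply: eq_bigr => k _; rewrite mxE.
apply: has_fps_sum_sum => k; apply: has_fps_sum_poly.
suff Gk : forall ij : 'I_n * 'I_p,
    has_fps_sum (G ij.1 ij.2) x (fps_sum (G ij.1 ij.2) x) by exact: (Gk (k, j)).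
by near: x.
Unshelve. all: by end_near. Qed.

Lemma entry_bound m n (M : 'M[C]_(m, n)) : exists2 b : C, 0 <= b &
  forall i j, `|M i j| <= b.
Proof.
exists (\sum_(ij : 'I_m * 'I_n) `|M ij.1 ij.2|); first exact: sumr_ge0.
by move=> i j; rewrite (bigD1 (i, j)) //= lerDl sumr_ge0.
Qed.

(** Write W(x) = W0 + x E(x) with E bounded.  Then W(x) W0^-1 = 1 + x E(x) W0^-1
    is within 1/2 of the identity for small x, so that
    |u| <= n z |u W(x)| + |u| / 2, z bounding the entries of W0^-1. *)
Lemma fps_sum_mx_bounds n (W : 'M[fps C]_n) :
  (forall i j, W i j \in @convergent C) ->
  map_mx (fun f => f`[0]) W \in unitmx ->
  exists2 K : C, 0 <= K &
    \forall x \near (0 : R)^'+, forall u : 'rV[C]_n,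
      l1 (u *m fps_sum_mx W x) <= K * l1 u /\ l1 u <= K * l1 (u *m fps_sum_mx W x).
Proof.
move=> Wc; set W0 := map_mx _ W => W0u.
have [M M0 WM] : exists2 M : C, 0 <= M & \forall x \near (0 : R)^'+,
    exists2 E : 'M[C]_n, fps_sum_mx W x = W0 + x%:C *: E
      & forall i j, `|E i j| <= M.
  have /choice[M HM] ij : exists M : C, 0 <= M /\ \forall x \near (0 : R)^'+,
      exists2 e : C, fps_sum (W ij.1 ij.2) x = (W ij.1 ij.2)`[0] + x%:C * e
        & `|e| <= M.
    by have [M ? ?] := fps_sum_cst_near (Wc ij.1 ij.2); exists M.
  exists (\sum_(ij : 'I_n * 'I_n) M ij); first by apply: sumr_ge0 => ij _; case: (HM ij).
  have : \forall x \near (0 : R)^'+, forall ij : 'I_n * 'I_n,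
      exists2 e : C, fps_sum (W ij.1 ij.2) x = (W ij.1 ij.2)`[0] + x%:C * e
        & `|e| <= M ij.
    by apply: filter_forall => ij; case: (HM ij).
  apply: filterS => x /(_ (_, _)) /= Wx.
  have /choice[e He] ij : exists e : C,
      fps_sum (W ij.1 ij.2) x = (W ij.1 ij.2)`[0] + x%:C * e /\ `|e| <= M ij.
    by case: ij => i j; have [e ? ?] := Wx i j; exists e.
  exists (\matrix_(i, j) e (i, j)).
    by apply/matrixP => i j; rewrite !mxE; case: (He (i, j)).
  move=> i j; rewrite mxE (bigD1 (i, j)) //=; apply: ler_wpDr.
    by apply: sumr_ge0 => ij _; case: (HM ij).
  by case: (He (i, j)).
have [w w0 Ww] := entry_bound W0; have [z z0 Wz] := entry_bound (invmx W0).
pose B := n%:R * z * (n%:R * M).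
have nz0 : 0 <= n%:R * z by rewrite mulr_ge0.
have nM0 : 0 <= n%:R * M by rewrite mulr_ge0.
have B0 : 0 <= B by rewrite mulr_ge0.
have nw0 : 0 <= n%:R * w by rewrite mulr_ge0.
have bE : B = (complex.Re B)%:C by rewrite RRe_real // ger0_real.
have b0 : 0 <= complex.Re B by rewrite -lecR -bE.
have bd0 : 0 < (2 * (1 + complex.Re B))^-1 by rewrite invr_gt0 mulr_gt0 // ltr_wpDr.
exists (2 * (n%:R * z) + (n%:R * w + n%:R * M)); first by rewrite !addr_ge0 // mulr_ge0.
near=> x; move=> u; have x0 : 0 <= x by exact: ltW.
have x1 : x <= 1 by near: x; exact: nbhs_right_le.
have xb : x <= (2 * (1 + complex.Re B))^-1 by near: x; exact: nbhs_right_le.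
have xB : x%:C * B <= 1 / 2.
  have -> : 1 / 2 = (1 / 2)%:C :> C by rewrite rmorphM fmorphV rmorph1 rmorph_nat.
  rewrite bE -rmorphM lecR; move: xb; rewrite -[_^-1]mul1r ler_pdivlMr; last first.
    by rewrite mulr_gt0 // ltr_wpDr.
  by move: x0; clear; lra.
have [E -> EM] : exists2 E : 'M[C]_n, fps_sum_mx W x = W0 + x%:C *: E
      & forall i j, `|E i j| <= M by near: x.
have xE : l1 (x%:C *: (u *m E)) <= x%:C * (n%:R * M * l1 u).
  by rewrite l1Z normc_real ger0_norm // ler_wpM2l ?lecR // l1_mulmx.
rewrite mulmxDr -scalemxAr; split.
  apply: le_trans (l1D _ _) _; rewrite mulrDl ler_wpDl ?mulr_ge0 ?l1_ge0 //.
  rewrite mulrDl lerD ?l1_mulmx //; apply: le_trans xE _.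
  by rewrite ler_piMl ?mulr_ge0 ?l1_ge0 // lecR.
set uW := u *m W0 + _.
have uE : u = uW *m invmx W0 + - 1 *: (x%:C *: (u *m E) *m invmx W0).
  by rewrite mulmxDl mulmxK // scaleN1r addrK.
have : l1 u <= n%:R * z * l1 uW + 1 / 2 * l1 u.
  rewrite {1}uE; apply: le_trans (l1D _ _) _; apply: lerD; first exact: l1_mulmx.
  rewrite l1Z normrN1 mul1r; apply: le_trans (l1_mulmx _ Wz) _.
  apply: le_trans (ler_wpM2l nz0 xE) _.
  rewrite (_ : n%:R * z * (x%:C * (n%:R * M * l1 u)) = x%:C * B * l1 u).
    by rewrite ler_wpM2r ?l1_ge0.
  by rewrite /B; ring.
rewrite -lerBlDr => uW2; rewrite mulrDl; apply: ler_wpDr.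
  by rewrite mulr_ge0 ?l1_ge0 ?addr_ge0.
rewrite -mulrA -ler_pdivrMl // mulrC; apply: le_trans uW2.
by rewrite le_eqVlt; apply/orP; left; apply/eqP; field.
Unshelve. all: by end_near. Qed.

End MatrixEval.

(** * The Smith form with convergent factors *)

Section ConstantTerm.
Variable K : fieldType.
Definition fps_const (f : fps K) : K := fps_coef f 0.

Fact fps_const_zmod_morphism : zmod_morphism fps_const.
Proof. by move=> f g. Qed.
Fact fps_const_monoid_morphism : monoid_morphism fps_const.
Proof.
by split=> [|f g]; [rewrite /fps_const /= coefC eqxx|exact: fps_coef0M].
Qed.
HB.instance Definition _ :=
  GRing.isZmodMorphism.Build _ _ fps_const fps_const_zmod_morphism.
HB.instance Definition _ :=
  GRing.isMonoidMorphism.Build _ _ fps_const fps_const_monoid_morphism.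

Lemma fps_const_unitmx n (M : 'M[fps K]_n) :
  M \in unitmx -> map_mx fps_const M \in unitmx.
Proof. by rewrite !unitmxE det_map_mx => /(rmorph_unit fps_const). Qed.

End ConstantTerm.
Arguments fps_const {K} f.

Section Smith.
Variable K : numFieldType.
Local Notation T := (fps_of_poly 'X : fps K).
Local Notation convergent := (@convergent K).

Lemma laurent_tX k : laurent_t K ^+ k = (T ^+ k)%:F.
Proof. by rewrite rmorphXn. Qed.

Lemma laurent_t_neq0 : laurent_t K != 0.
Proof. by rewrite tofrac_eq0 fps_T_neq0. Qed.

Lemma convergent_laurent_num (m : nat) (g : fps K) (a : laurent K) :
  algebraicOver (@laurent_of_ratfun K) a -> a = g%:F / laurent_t K ^+ m ->
  g \in convergent.
Proof.
move=> alg aE; apply: convergent_algebraic.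
have -> : g%:F = a * laurent_of_ratfun ('X ^+ m)%:F.
  rewrite laurent_of_ratfun_poly rmorphXn -laurent_tX aE mulfVK //.
  by rewrite expf_neq0 // laurent_t_neq0.
by apply: algebraic_mul alg _; exact: algebraic_id.
Qed.

(** B is the truncation of A1^-1 at an order N larger than every exponent.  The
    error t^N C G is divisible by each t^(w i), with a quotient that vanishes at
    0; it is absorbed in W, whose constant term is therefore that of A2. *)
Lemma smith_convergent n (A1 A2 G : 'M[fps K]_n) (w : 'I_n -> nat) :
  A1 \in unitmx -> A2 \in unitmx -> (forall i j, G i j \in convergent) ->
  G = A1 *m diag_mx (\row_i T ^+ w i) *m A2 ->
  exists (B : 'M[{poly K}]_n) (W : 'M[fps K]_n), [/\
    map_mx (@fps_of_poly K) B *m G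
      = map_mx (@fps_of_poly K) (diag_mx (\row_i 'X ^+ w i)) *m W,
    forall i j, W i j \in convergent,
    map_mx fps_const (map_mx (@fps_of_poly K) B) \in unitmx
    & map_mx fps_const W \in unitmx].
Proof.
move=> A1u A2u Gc GE; pose D := diag_mx (\row_i T ^+ w i).
have DE : map_mx (@fps_of_poly K) (diag_mx (\row_i 'X ^+ w i)) = D.
  rewrite map_diag_mx; congr diag_mx; apply/rowP => i; rewrite !mxE.
  by rewrite rmorphXn.
pose N := (\sum_i w i).+1.
have wN i : (w i < N)%N by rewrite ltnS (bigD1 i) //= leq_addr.
pose B := map_mx (@fps_trunc K N) (invmx A1).
pose C := map_mx (@fps_drop K N) (invmx A1).
have BE : map_mx (@fps_of_poly K) B = invmx A1 - T ^+ N *: C.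
  apply/matrixP => i j; rewrite !mxE.
  by rewrite [X in _ = X - _](fps_split N) addrK.
pose W := A2 - \matrix_(i, j) (T ^+ (N - w i) * (C *m G) i j).
have BG : map_mx (@fps_of_poly K) B *m G = D *m W.
  rewrite BE mulmxBl mulmxBr; congr (_ - _).
    by rewrite [in LHS]GE -(mulmxA A1) mulKmx.
  rewrite -scalemxAl; move: (C *m G) => H; apply/matrixP => i j.
  rewrite mul_diag_mx [LHS]mxE ![in RHS]mxE mulrA -exprD subnKC //.
  exact: ltnW.
exists B, W; split.
- by rewrite DE.
- move=> i j; apply: (@convergent_divT _ (w i)).
  have -> : T ^+ w i * W i j = (D *m W) i j by rewrite mul_diag_mx !mxE.
  rewrite -BG mxE rpred_sum // => k _; rewrite rpredM // mxE.
  exact: convergent_poly.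
- have -> : map_mx fps_const (map_mx (@fps_of_poly K) B) = map_mx fps_const (invmx A1).
    apply/matrixP => i j; rewrite !mxE /fps_const /= coef_poly //.
  by apply: fps_const_unitmx; rewrite unitmx_inv.
have -> : map_mx fps_const W = map_mx fps_const A2.
  apply/matrixP => i j; rewrite !mxE rmorphB.
  rewrite [X in _ - X](_ : _ = 0) ?subr0 //.
  by apply: etrans (fps_coefTnM _ _ _) _; rewrite subn_gt0 wN.
exact: fps_const_unitmx.
Qed.

End Smith.

Section LaurentEval.
Variable R : realType.
Local Notation C := R[i].
Local Notation T := (fps_of_poly 'X : fps C).

(** Multiplication by t^m brings A and the diagonal factor into power series;
    m dominates all the pole orders and all the |v i|. *)
Lemma laurent_matrix n (A : 'M[laurent C]_n) (v : 'I_n -> int) :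
  (forall i j, algebraicOver (@laurent_of_ratfun C) (A i j)) ->
  invariant_factors A v ->
  exists (m : nat) (w : 'I_n -> nat) (A1 A2 G : 'M[fps C]_n),
   [/\ forall i, v i = (w i)%:Z - m%:Z, A1 \in unitmx /\ A2 \in unitmx,
     forall i j, G i j \in @convergent C,
     G = A1 *m diag_mx (\row_i T ^+ w i) *m A2
   & \forall x \near (0 : R)^'+, x%:C ^+ m *: eval_mx A x = fps_sum_mx G x].
Proof.
move=> alg [A1 [A2 [A1u A2u AE]]].
pose g i j := laurent_repr (A i j).
have gE i j : A i j = (g i j).2%:F / laurent_t C ^+ (g i j).1.
  by rewrite /g /laurent_repr; case: cid => p /=.
have gc i j : (g i j).2 \in @convergent C.
  exact: convergent_laurent_num (alg i j) (gE i j).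
pose m := (\sum_(ij : 'I_n * 'I_n) (g ij.1 ij.2).1 + \sum_i `|v i|)%N.
have gm i j : ((g i j).1 <= m)%N.
  by rewrite /m (bigD1 (i, j)) //= -!addnA leq_addr.
have vm i : 0 <= v i + m%:Z.
  have : (`|v i| <= m)%N by rewrite /m (bigD1 i (F := fun i => absz (v i))) //=; lia.
  by lia.
pose w i := absz (v i + m%:Z).
have wE i : (w i)%:Z = v i + m%:Z by rewrite /w gez0_abs.
pose G := \matrix_(i, j) (T ^+ (m - (g i j).1) * (g i j).2).
have GE : map_mx (@FracField.tofrac _) G = laurent_t C ^+ m *: A.
  apply/matrixP => i j; rewrite !mxE gE tofracM -laurent_tX.
  rewrite -{2}(subnK (gm i j)) exprD [_%:F / _]mulrC -!mulrA mulVKf //.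
  by rewrite expf_neq0 // laurent_t_neq0.
exists m, w, A1, A2, G; split.
- by move=> i; rewrite wE addrK.
- by split.
- by move=> i j; rewrite mxE rpredM // rpredX // convergent_poly.
- have tofrac_inj : injective (@FracField.tofrac (fps C)).
    by move=> a b /eqP; rewrite tofrac_eq => /eqP.
  suff GE' : map_mx (@FracField.tofrac _) G
      = map_mx (@FracField.tofrac _) (A1 *m diag_mx (\row_i T ^+ w i) *m A2).
    apply/matrixP => i j; apply: tofrac_inj; move/matrixP/(_ i j): GE'.
    by rewrite [LHS]mxE [RHS]mxE.
  rewrite GE AE !map_mxM scalemxAl scalemxAr.
  congr (_ *m _ *m _); rewrite map_diag_mx.
  apply/matrixP => i j; rewrite !mxE.
  case: eqP => [_|]; last by rewrite !mulr0n mulr0.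
  rewrite !mulr1n [RHS]rmorphXn -[RHS]/(laurent_t C ^ (w i)%:Z) wE addrC.
  by rewrite expfzDr ?laurent_t_neq0.
have Gx : \forall x \near (0 : R)^'+, forall ij : 'I_n * 'I_n,
    has_fps_sum (g ij.1 ij.2).2 x (fps_sum (g ij.1 ij.2).2 x).
  apply: filter_forall => ij; have [M _] := fps_sum_near (gc ij.1 ij.2).
  by apply: filterS => x [].
near=> x; have x0 : 0 < x by [].
have xC0 : x%:C != 0 :> C.
  by rewrite -(rmorph0 (real_complex R)) (inj_eq (@complexI _)) gt_eqF.
apply/matrixP => i j; rewrite !mxE; apply/esym.
have -> : laurent_eval (A i j) x = fps_sum (g i j).2 x / x%:C ^+ (g i j).1.
  by rewrite /laurent_eval -/(g i j); case: (g i j).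
rewrite -rmorphXn; have -> : x%:C ^+ m * (fps_sum (g i j).2 x / x%:C ^+ (g i j).1)
    = ('X ^+ (m - (g i j).1)).[x%:C] * fps_sum (g i j).2 x.
  rewrite hornerXn -{1}(subnK (gm i j)) exprD -mulrA; congr (_ * _).
  by rewrite mulrC mulfVK // expf_neq0.
apply/has_fps_sumE/has_fps_sum_poly.
suff Gg : forall ij : 'I_n * 'I_n,
    has_fps_sum (g ij.1 ij.2).2 x (fps_sum (g ij.1 ij.2).2 x) by exact: (Gg (i, j)).
by near: x.
Unshelve. all: by end_near. Qed.

End LaurentEval.

(** * Logarithmic asymptotics *)

Section SingularValueBounds.
Variable R : realType.
Local Notation C := R[i].
Local Open Scope sesquilinear_scope.

(** compare_diag is applied in both directions between the singular values and
    e: the change of coordinates is P B^-1 in one and its inverse B P^* in the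
    other.  J and L index the i-th and later, respectively earlier, entries. *)
Lemma singular_values_bounds n (M B W : 'M[C]_n) (e : 'I_n -> R) (KB KW : C) :
  B *m M = diag_mx (\row_i (e i)%:C) *m W ->
  (forall i, 0 <= e i) -> (forall i j : 'I_n, (i <= j)%N -> e i <= e j) ->
  0 <= KB -> 0 <= KW ->
  (forall u : 'rV_n, l1 (u *m B) <= KB * l1 u /\ l1 u <= KB * l1 (u *m B)) ->
  (forall u : 'rV_n, l1 (u *m W) <= KW * l1 u /\ l1 u <= KW * l1 (u *m W)) ->
  forall i : 'I_n,
    ((singular_values M)`_i)%:C <= n%:R ^+ 2 * KB * KW * (e i)%:C /\
    (e i)%:C <= n%:R ^+ 2 * KB * KW * ((singular_values M)`_i)%:C.
Proof.
set D := \row_i _; move=> BM e0 e_le KB0 KW0 Bb Wb i.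
have [P [d [Pu dE s0 Pd]]] := singular_values_diag M.
have n0 : 0 <= n%:R :> C by [].
have s_le (j k : 'I_n) : (j <= k)%N -> (singular_values M)`_j <= (singular_values M)`_k.
  move=> jk; apply: (sorted_leq_nth le_trans lexx) => //; last first.
  - by rewrite inE size_singular_values.
  - by rewrite inE size_singular_values.
  - by apply: sort_sorted; exact: le_total.
have d_norm j : `|d 0 j| = ((singular_values M)`_j)%:C.
  by rewrite dE normc_real ger0_norm.
have e_norm j : `|D 0 j| = (e j)%:C :> C.
  by rewrite mxE normc_real ger0_norm.
have Bu : B \in unitmx.
  rewrite -row_free_unit -kermx_eq0; apply: contraT => /rowV0Pn[u /sub_kermxP uB u0].
  have [_] := Bb u; rewrite uB => ul.
  have l10 : l1 (0 : 'rV[C]_n) = 0 by rewrite /l1 big1 // => k _; rewrite mxE normr0.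
  by have := lt_le_trans (l1_gt0 u0) ul; rewrite l10 mulr0 ltxx.
have PP : P ^t* *m P = 1%:M by rewrite -invmx_unitary // mulVmx // unitarymx_unit.
pose J := [set j : 'I_n | (i <= j)%N]%SET; pose L := [set j : 'I_n | (j <= i)%N]%SET.
have JL : (n < #|J| + #|L|)%N.
  rewrite -cardsUI.
  have -> : J :|: L = [set: 'I_n]%SET by apply/setP => j; rewrite !inE leq_total.
  have -> : J :&: L = [set i]%SET by apply/setP => j; rewrite !inE -eqn_leq eq_sym.
  by rewrite cardsT card_ord cards1 addn1.
split.
- have -> : n%:R ^+ 2 * KB * KW * (e i)%:C = (n%:R * KW) * (KB * n%:R) * (e i)%:C by ring.
  apply: (@compare_diag _ _ (P *m invmx B) d D J L) => //.
  + by rewrite lecR.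
  + exact: mulr_ge0.
  + by move=> j; rewrite inE d_norm lecR; exact: s_le.
  + by move=> j; rewrite inE e_norm lecR; exact: e_le.
  + move=> u; apply: le_trans (l1_le_l2 (esym (Pd u))) _; rewrite -mulrA ler_wpM2l //.
    have -> : u *m P *m M = u *m (P *m invmx B) *m diag_mx D *m W.
      by rewrite -(mulmxA _ (diag_mx _)) -BM mulmxA [u *m (P *m _)]mulmxA mulmxKV.
    by case: (Wb (u *m (P *m invmx B) *m diag_mx D)).
  + move=> u; have [_] := Bb (u *m (P *m invmx B)); rewrite -!mulmxA mulVmx // mulmx1.
    move=> uP; apply: le_trans uP _; rewrite -mulrA ler_wpM2l //.
    by apply: l1_le_l2; rewrite l2sq_unitary.
have -> : n%:R ^+ 2 * KB * KW * ((singular_values M)`_i)%:C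
    = (KW * n%:R) * (n%:R * KB) * ((singular_values M)`_i)%:C by ring.
apply: (@compare_diag _ _ (B *m P ^t*) D d J L) => //.
- by rewrite lecR.
- exact: mulr_ge0.
- by move=> j; rewrite inE e_norm lecR; exact: e_le.
- by move=> j; rewrite inE d_norm lecR; exact: s_le.
- move=> u; have [_ uW] := Wb (u *m diag_mx D).
  apply: le_trans uW _; rewrite -mulrA ler_wpM2l //.
  rewrite -(mulmxA u (diag_mx D)) -BM.
  apply: l1_le_l2; rewrite -Pd; congr l2sq.
  by rewrite !mulmxA -(mulmxA (u *m B)) PP mulmx1.
move=> u; apply: (@le_trans _ _ (n%:R * l1 (u *m B))).
  by apply: l1_le_l2; rewrite mulmxA l2sq_unitaryC.
by rewrite -mulrA ler_wpM2l //; case: (Bb u).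
Qed.

End SingularValueBounds.

Section Logarithm.
Variable R : realType.

Lemma ler_exprz_le1 (x : R) (k l : int) :
  0 < x -> x <= 1 -> l <= k -> x ^ k <= x ^ l.
Proof.
move=> x0 x1; rewrite -subr_ge0 => /gez0_abs kl.
rewrite -(subrK l k) -kl addrC expfzDr ?gt_eqF // ler_piMr ?exprz_ge0 ?(ltW x0) //.
by rewrite -exprnP exprn_ile1 // ltW.
Qed.

Lemma ln_exprz (x : R) (k : int) : 0 < x -> ln (x ^ k) = k%:~R * ln x.
Proof.
move=> x0; case: k => k; first by rewrite -exprnP lnXn // -mulr_natl.
by rewrite NegzE -exprnN lnV ?posrE ?exprn_gt0 // lnXn // rmorphN mulNr -mulr_natl.
Qed.

(** |ln s - k ln x| <= |ln K|, to be divided by |ln x|, which is large. *)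
Lemma log_base_close (K x s : R) (k : int) (eps : R) :
  0 <= K -> 0 < x -> x < 1 -> 0 < eps -> s <= K * x ^ k -> x ^ k <= K * s ->
  x <= expR (- (`|ln K| / eps)) ->
  `|k%:~R - log_base x s| <= eps.
Proof.
move=> K_ge0 x0 x1 eps0 sK Ks xK; have xk0 : 0 < x ^ k by rewrite exprz_gt0.
have lnx : ln x < 0 by rewrite ln_lt0 // x0.
have Ks0 : 0 < K * s := lt_le_trans xk0 Ks.
have K0 : 0 < K.
  rewrite lt_neqAle K_ge0 andbT eq_sym.
  by apply: contraTneq Ks0 => ->; rewrite mul0r ltxx.
have s0 : 0 < s by rewrite -(pmulr_rgt0 _ K0).
have lns_le : ln s <= ln K + k%:~R * ln x.
  by rewrite -ln_exprz // -lnM ?posrE // ler_ln ?posrE ?mulr_gt0.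
have lns_ge : k%:~R * ln x <= ln K + ln s.
  by rewrite -ln_exprz // -lnM ?posrE // ler_ln ?posrE ?mulr_gt0.
have xK' : ln x <= - (`|ln K| / eps).
  by rewrite -(expRK (- _)) ler_ln ?posrE // expR_gt0.
rewrite /log_base.
have -> : k%:~R - ln s / ln x = (k%:~R * ln x - ln s) / ln x.
  by rewrite mulrBl mulfK // lt_eqF.
rewrite normrM normfV ler_pdivrMr ?normr_gt0 ?lt_eqF // (ltr0_norm lnx).
apply: (@le_trans _ _ `|ln K|).
  rewrite ler_norml; apply/andP; split.
    by move: (ler_norm (ln K)); lra.
  by move: (ler_norm (ln K)); lra.
rewrite -ler_pdivrMl // mulrC; lra.
Qed.

End Logarithm.

Lemma singular_values_equiv (R : realType) n (A : 'M[laurent R[i]]_n)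
    (v : 'I_n -> int) :
  (forall i j, algebraicOver (@laurent_of_ratfun R[i]) (A i j)) ->
  invariant_factors A v ->
  (forall i j : 'I_n, (i <= j)%N -> v j <= v i) ->
  exists2 K : R, 0 <= K & \forall x \near (0 : R)^'+, forall i : 'I_n,
    (singular_values (eval_mx A x))`_i <= K * x ^ v i /\
    x ^ v i <= K * (singular_values (eval_mx A x))`_i.
Proof.
move=> alg inv v_le.
have [m [w [A1 [A2 [G [vE [A1u A2u] Gc GE Gx]]]]]] := laurent_matrix alg inv.
have [B [W [BG Wc Bu Wu]]] := smith_convergent A1u A2u Gc GE.
pose Bf := map_mx (@fps_of_poly R[i]) B.
have Bc i j : Bf i j \in @convergent R[i] by rewrite mxE convergent_poly.
have [KB KB0 KBx] := fps_sum_mx_bounds Bc Bu.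
have [KW KW0 KWx] := fps_sum_mx_bounds Wc Wu.
pose K := n%:R ^+ 2 * KB * KW.
have K0 : 0 <= K by rewrite !mulr_ge0 ?exprn_ge0.
have KE : K = (complex.Re K)%:C by rewrite RRe_real // ger0_real.
have BGx := fps_sum_mx_poly_mul B Gc.
have DWx := fps_sum_mx_poly_mul (diag_mx (\row_i 'X ^+ w i)) Wc.
exists (complex.Re K); first by rewrite -lecR -KE.
near=> x; have x0 : 0 < x by [].
have x1 : x <= 1 by near: x; exact: nbhs_right_le.
have xC0 : x%:C != 0 :> R[i].
  by rewrite -(rmorph0 (real_complex R)) (inj_eq (@complexI _)) gt_eqF.
have BfE : fps_sum_mx Bf x = map_mx (fun q => q.[x%:C]) B.
  by apply/matrixP => i j; rewrite !mxE fps_sum_poly.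
have BM : fps_sum_mx Bf x *m eval_mx A x
    = diag_mx (\row_i (x ^ v i)%:C) *m fps_sum_mx W x.
  apply: (scalerI (expf_neq0 m xC0)).
  have GxE := near Gx x; have BGE := near BGx x; have DWE := near DWx x.
  rewrite scalemxAr GxE // BfE -BGE // BG DWE // scalemxAl; congr (_ *m _).
  apply/matrixP => i j; rewrite !mxE.
  case: eqP => _; last by rewrite !mulr0n mulr0 horner0.
  rewrite !mulr1n hornerXn -!rmorphXn -rmorphM; congr (_%:C).
  by rewrite -[x ^+ m]/(x ^ m%:Z) -expfzDr ?gt_eqF // vE addrC subrK.
have KBb := near KBx x; have KWb := near KWx x.
have e0 i : 0 <= x ^ v i by rewrite exprz_ge0 // ltW.
have e_le (i j : 'I_n) : (i <= j)%N -> x ^ v i <= x ^ v j.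
  by move=> ij; rewrite ler_exprz_le1 ?v_le.
move=> i; rewrite -!lecR !rmorphM /= -KE.
exact: (singular_values_bounds BM e0 e_le KB0 KW0 (KBb _) (KWb _)).
Unshelve. all: by end_near. Qed.

Theorem corollary6 (R : realType) (n : nat) (A : 'M[laurent R[i]]_n)
    (v : 'I_n -> int) :
  A \in unitmx ->
  (forall i j, algebraicOver (@laurent_of_ratfun R[i]) (A i j)) ->
  invariant_factors A v ->
  (forall i j : 'I_n, (i <= j)%N -> v j <= v i) ->
  \row_(i < n) log_base t (singular_values (eval_mx A t))`_i @[t --> (0 : R)^'+]
    --> \row_(i < n) ((v i)%:~R : R).
Proof.
move=> _ alg inv v_le; have [K K0 Kx] := singular_values_equiv alg inv v_le.
apply/cvg_ballP => eps eps0; near=> x.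
have x0 : 0 < x by [].
have x1 : x < 1 by near: x; exact: nbhs_right_lt.
(* The bound of log_base_close is not strict, hence eps / 2. *)
have xK : x <= expR (- (`|ln K| / (eps / 2))).
  by near: x; apply: nbhs_right_le; exact: expR_gt0.
split=> // i0 i; rewrite [(\row_i _) i0 i]mxE [(\row_i _) i0 i]mxE -ball_normE /=.
have sK : (singular_values (eval_mx A x))`_i <= K * x ^ v i /\
    x ^ v i <= K * (singular_values (eval_mx A x))`_i by move: (i); near: x.
apply: le_lt_trans (_ : eps / 2 < eps); last by rewrite ltr_pdivrMr // ltr_pMr // ltr1n.
by case: sK => sK Ks; apply: log_base_close sK Ks xK => //; rewrite divr_gt0.
Unshelve. all: by end_near. Qed.
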